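(* Let $d\in\{1,2,3\}$, $m\ge0$, and consider a potential $V\in\overline{\mathcal{R}}^{m,p}_{d,\frac d2}$ for some $p\ge4$ such that $V_-\in L^\infty(\mathbb{R}^d)$. Then the Schr\''odinger operator $H=L_{m,\frac d2}+V$ is self-adjoint in the form sense.
   Context: For $\alpha\in(0,2)$, $m\ge0$, $L_{m,\alpha}=(-\Delta+m^{2/\alpha})^{\alpha/2}-m$ on $L^2(\mathbb{R}^d)$ is the non-negative self-adjoint operator with Fourier multiplier $(|y|^2+m^{2/\alpha})^{\alpha/2}-m$ (for $m=0$: $|y|^\alpha$). Its quadratic form is $[u]^2_{m,\alpha}=\frac12\int_{\mathbb{R}^d}\int_{\mathbb{R}^d}|u(x+h)-u(x)|^2j_{m,\alpha}(|h|)\,dx\,dh$, where $j_{0,\alpha}(r)=\frac{2^\alpha\Gamma(\frac{d+\alpha}{2})}{\pi^{d/2}|\Gamma(-\frac\alpha2)|}r^{-d-\alpha}$ and, for $m>0$, $j_{m,\alpha}(r)=\frac{2^{\frac{\alpha-d}{2}}m^{\frac{d+\alpha}{2\alpha}}\alpha}{\pi^{d/2}\Gamma(1-\frac\alpha2)}\frac{K_{(d+\alpha)/2}(m^{1/\alpha}r)}{r^{(d+\alpha)/2}}$, with form domain $H^{\alpha/2}(\mathbb{R}^d)$ (the fractional Sobolev space). $K_\rho(z)=\frac12(\frac z2)^\rho\int_0^\infty t^{-\rho-1}e^{-t-\frac{z^2}{4t}}dt$ is the modified Bessel function of the second kind. For a potential $V$, ''$H=L_{m,\alpha}+V$ is self-adjoint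 in the form sense'' means that $\mathcal{A}^V_{m,\alpha}[u]=[u]^2_{m,\alpha}+\int_{\mathbb{R}^d}V(x)|u(x)|^2dx$ with domain $H^{\alpha/2}(\mathbb{R}^d)\cap L^2(\mathbb{R}^d,|V|dx)$ (and value $+\infty$ outside of it) is a bounded below, lower semicontinuous (closed) quadratic form on $L^2(\mathbb{R}^d)$, so that $H$ is the self-adjoint operator associated with it. For $d<2\alpha$ and $m\ge0$, $\overline{\mathcal{R}}^m_{d,\alpha}$ is the set of measurable $V:\mathbb{R}^d\to\mathbb{R}$ with $$\int_{\mathbb{R}^d}\int_{\mathbb{R}^d}H^m_{d,\alpha}(|x-y|)^2|V(x)||V(y)|\,dx\,dy<\infty .$$ Here, for $r>0$, $h(r)=r^{-(d-\alpha)}$ if $\alpha<d$, $h(r)=\log(1+\frac1r)$ if $\alpha=d=1$, $h(r)=1$ if $\alpha>d=1$; $H^0_{d,\alpha}(r)=h(r)\mathbf{1}_{\{r\le1\}}+2^{\frac{d+\alpha}{2}-1}\Gamma(\frac{d+\alpha}{2})r^{-(d+\alpha)}\mathbf{1}_{\{r>1\}}$; and for $m>0$, $H^m_{d,\alpha}(r)=h(r)\mathbf{1}_{\{r\le1\}}+r^{-\frac{d+\alpha}{2}}\kappa_m(r)\mathbf{1}_{\{r>1\}}$ with $\kappa_m(r)=m^{(d+\alpha)/(2\alpha)}K_{(d+\alpha)/2}(m^{1/\alpha}r)$. For $p>1$, $$\overline{\mathcal{R}}^{m,p}_{d,\frac d2}=L^p(\mathbb{R}^d)\cap\liminf_{\alpha\downarrow\frac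 d2}\overline{\mathcal{R}}^m_{d,\alpha},\qquad \liminf_{\alpha\downarrow\frac d2}\overline{\mathcal{R}}^m_{d,\alpha}=\bigcup_{\beta\in(\frac d2,\,\min\{d,2\})}\ \bigcap_{\alpha\in(\frac d2,\beta)}\overline{\mathcal{R}}^m_{d,\alpha}.$$ $V_-=\max\{-V,0\}$. *)

(* Defs.v *)
From HB Require Import structures.
From mathcomp Require Import all_boot all_order all_algebra.
From mathcomp Require Import all_classical all_reals all_analysis.
From mathcomp Require Import complex.

Set Implicit Arguments.
Unset Strict Implicit.
Unset Printing Implicit Defensive.

Import Order.TTheory GRing.Theory Num.Theory.
Import numFieldNormedType.Exports.

Local Open Scope classical_set_scope.
Local Open Scope ring_scope.

(* R^d is [d.-tuple R] with the product Borel sigma-algebra.  (On row vectors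
   the library has no measurable structure and its norm is the max norm.) *)

Section euclidean_space.
Context {R : realType} {d : nat}.
Implicit Types x y : d.-tuple R.

Definition tadd x y : d.-tuple R := [tuple tnth x i + tnth y i | i < d].

Definition tsub x y : d.-tuple R := [tuple tnth x i - tnth y i | i < d].

Definition enorm x : R := Num.sqrt (\sum_(i < d) tnth x i ^+ 2).

Definition tcons (p : R * d.-tuple R) : d.+1.-tuple R := [tuple of p.1 :: p.2].

Lemma measurable_tcons : measurable_fun [set: R * d.-tuple R] tcons.
Proof. exact: measurable_cons. Qed.

(* The image of (Lebesgue measure) x mu under [tcons].  The variant [\x^] of
   the product measure only needs its left factor to be sigma-finite. *)
Definition leb_cons (mu : {measure set (d.-tuple R) -> \bar R}) :
    set (d.+1.-tuple R) -> \bar R :=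
  pushforward (lebesgue_measure \x^ mu)%E tcons.

HB.instance Definition _ (mu : {measure set (d.-tuple R) -> \bar R}) :=
  Measure.copy (leb_cons mu)
    (measure_function_pushforward__canonical__measure_function_Measure
       (lebesgue_measure \x^ mu)%E measurable_tcons).

End euclidean_space.

Fixpoint leb (R : realType) (d : nat) : {measure set (d.-tuple R) -> \bar R} :=
  match d return {measure set (d.-tuple R) -> \bar R} with
  | 0 => @dirac _ (0.-tuple R) [tuple] R
  | d'.+1 => @leb_cons R d' (leb R d')
  end.

Lemma leb_box (R : realType) (d : nat) (A : 'I_d -> set R) :
  (forall i, measurable (A i)) ->
  leb R d [set x | forall i, A i (tnth x i)]
  = (\prod_(i < d) lebesgue_measure (A i))%E.
Proof.
elim: d A => [|d IHd] A mA.
  rewrite big_ord0 /= diracE mem_set//; by case.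
have mB : measurable
    [set x : d.-tuple R | forall i, A (lift ord0 i) (tnth x i)].
  rewrite (_ : [set _ | _] =
      \bigcap_(i in [set: 'I_d]) ((@tnth d R)^~ i @^-1` A (lift ord0 i))).
    apply: fin_bigcap_measurable => //= i _; rewrite -[X in measurable X]setTI.
    by apply: measurable_tnth.
  by apply/seteqP; split => x /= xA i; [move=> _; exact: xA|exact: xA].
rewrite big_ord_recl -IHd; last by move=> i; exact: mA.
rewrite -[RHS](product_measure2E lebesgue_measure (leb R d) (mA ord0) mB).
change (leb_cons (leb R d) [set x | forall i, A i (tnth x i)] =
  (lebesgue_measure \x^ leb R d)%E
    (A ord0 `*` [set x | forall i, A (lift ord0 i) (tnth x i)])).
rewrite /leb_cons /pushforward; congr ((_ \x^ _)%E _).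
apply/seteqP; split => -[a x] /=.
- move=> aA; split; first by have := aA ord0; rewrite tnth0.
  by move=> i; have := aA (lift ord0 i); rewrite tnthS.
- move=> [a0 xA] i; case: (unliftP ord0 i) => [j|] ->.
    by rewrite tnthS; exact: xA.
  by rewrite tnth0.
Qed.

Section special_functions.
Context {R : realType}.
Implicit Types x z rho : R.

Definition gamma_int x : R :=
  \int[@lebesgue_measure R]_(t in `]0, +oo[) (t `^ (x - 1) * expR (- t)).

(* Euler's Gamma function, extended to the non-integers [x < 0] by
   Gamma (x) = Gamma (x + n) / (x (x + 1) ... (x + n - 1)) where n is the least
   natural number with x + n > 0. *)
Definition gamma x : R :=
  if 0 < x then gamma_int x
  else let n := (Num.truncn (- x)).+1 in
       gamma_int (x + n%:R) / \prod_(k < n) (x + k%:R).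

Definition besselK rho z : R :=
  2^-1 * (z / 2) `^ rho *
  \int[@lebesgue_measure R]_(t in `]0, +oo[)
    (t `^ (- rho - 1) * expR (- t - z ^+ 2 / (4 * t))).

End special_functions.

Section potentials.
Context {R : realType} (d : nat).
Implicit Types (m alpha r p : R) (V : d.-tuple R -> R).

Definition jkernel m alpha r : R :=
  if m == 0 then
    2 `^ alpha * gamma ((d%:R + alpha) / 2) /
      (pi `^ (d%:R / 2) * `|gamma (- (alpha / 2))|) * r `^ (- d%:R - alpha)
  else
    2 `^ ((alpha - d%:R) / 2) * m `^ ((d%:R + alpha) / (2 * alpha)) * alpha /
      (pi `^ (d%:R / 2) * gamma (1 - alpha / 2)) *
    (besselK ((d%:R + alpha) / 2) (m `^ alpha^-1 * r) /
       r `^ ((d%:R + alpha) / 2)).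

(* For alpha < 2 the last two branches only occur with d = 1. *)
Definition hkernel alpha r : R :=
  if alpha < d%:R then r `^ (- (d%:R - alpha))
  else if alpha == d%:R then ln (1 + r^-1)
  else 1.

Definition kappa m alpha r : R :=
  m `^ ((d%:R + alpha) / (2 * alpha)) *
  besselK ((d%:R + alpha) / 2) (m `^ alpha^-1 * r).

Definition Hkernel m alpha r : R :=
  if r <= 1 then hkernel alpha r
  else if m == 0 then
    2 `^ ((d%:R + alpha) / 2 - 1) * gamma ((d%:R + alpha) / 2) *
      r `^ (- (d%:R + alpha))
  else r `^ (- ((d%:R + alpha) / 2)) * kappa m alpha r.

Definition Rbar m alpha : set (d.-tuple R -> R) :=
  [set V : d.-tuple R -> R | measurable_fun [set: d.-tuple R] V /\
    (\int[leb R d]_x \int[leb R d]_y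
       (Hkernel m alpha (enorm (tsub x y)) ^+ 2 * `|V x| * `|V y|)%:E
     < +oo)%E].

Definition liminf_Rbar m : set (d.-tuple R -> R) :=
  \bigcup_(beta in [set` `]d%:R / 2, Num.min d%:R 2[ ])
    \bigcap_(alpha in [set` `]d%:R / 2, beta[ ]) Rbar m alpha.

Definition Rbar_critical m p : set (d.-tuple R -> R) :=
  [set V : d.-tuple R -> R | V \in Lfun (leb R d) p%:E] `&` liminf_Rbar m.

End potentials.

Section forms.
Context {R : realType} {d : nat}.
Local Notation C := R[i].
Local Notation E := (d.-tuple R).
Implicit Types (u v w : E -> C) (D : set (E -> C)) (q : (E -> C) -> \bar R).

Definition cabs (z : C) : R := complex.Re `|z|.

Definition L2norm u : \bar R := 'N[leb R d]_2%:E[EFin \o (cabs \o u)]%E.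

(* L^2(R^d; C), as functions; a form on equivalence classes is a form on these
   that is constant on classes, which lower semicontinuity below enforces. *)
Definition L2 : set (E -> C) :=
  [set u : E -> C | [/\ measurable_fun setT (fun x => complex.Re (u x)),
               measurable_fun setT (fun x => complex.Im (u x)) &
               (L2norm u < +oo)%E]].

(* H^s(R^d), 0 < s < 1, by finiteness of the Gagliardo seminorm. *)
Definition Hsobolev (s : R) : set (E -> C) :=
  [set u : E -> C | L2 u /\
    (\int[leb R d]_x \int[leb R d]_y
       (cabs (u x - u y) ^+ 2 / enorm (tsub x y) `^ (d%:R + 2 * s))%:E
     < +oo)%E].

Definition kinetic (m alpha : R) u : \bar R :=
  ((2^-1)%:E * \int[leb R d]_h \int[leb R d]_x
     (cabs (u (tadd x h) - u x) ^+ 2 * jkernel d m alpha (enorm h))%:E)%E.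

Definition form_domain (alpha : R) (V : E -> R) : set (E -> C) :=
  Hsobolev (alpha / 2) `&`
  [set u : E -> C | (\int[leb R d]_x (`|V x| * cabs (u x) ^+ 2)%:E < +oo)%E].

Definition schrodinger_form (m alpha : R) (V : E -> R) u : \bar R :=
  if `[< form_domain alpha V u >] then
    (kinetic m alpha u + \int[leb R d]_x (V x * cabs (u x) ^+ 2)%:E)%E
  else +oo%E.

(* q takes finite values on the linear subspace D of L^2, where it is the
   diagonal of a Hermitian sesquilinear form, and the value +oo outside of D. *)
Definition quadratic_form D q : Prop :=
  [/\ D `<=` L2, D (fun=> 0),
      forall (a : C) u v, D u -> D v -> D (fun x => a * u x + v x),
      exists s : (E -> C) -> (E -> C) -> C,
        [/\ forall (a : C) u v w, D u -> D v -> D w ->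
              s u (fun x => a * v x + w x) = a * s u v + s u w,
            forall u v, D u -> D v -> s v u = (s u v)^* &
            forall u, D u -> q u = (complex.Re (s u u))%:E] &
      forall u, ~ D u -> q u = +oo%E].

Definition L2dense D : Prop :=
  forall u (e : R), L2 u -> 0 < e ->
  exists2 v, D v & (L2norm (fun x => v x - u x)%R < e%:E)%E.

Definition bounded_below q : Prop :=
  exists c : R, forall u, L2 u -> (c%:E * L2norm u ^+ 2 <= q u)%E.

Definition L2_lower_semicontinuous q : Prop :=
  forall u (a : R), L2 u -> (a%:E < q u)%E ->
  exists2 e : R, 0 < e &
    forall v, L2 v -> (L2norm (fun x => v x - u x)%R < e%:E)%E ->
      (a%:E < q v)%E.

(* Density of the domain is what makes an operator on L^2 be associated with
   the closed form. *)
Definition self_adjoint_form_sense (m alpha : R) (V : E -> R) : Prop :=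
  let D := form_domain alpha V in
  let q := schrodinger_form m alpha V in
  [/\ quadratic_form D q, L2dense D, bounded_below q &
      L2_lower_semicontinuous q].

End forms.

(* Main.v *)
(** Fix [c >= ess sup V_-] and [W := max (V + c) 0].  On [L^2] the form is
    [F u - c |u|^2] with [F u = kinetic u + \int W |u|^2], and both summands of
    [F] are weighted energies [\int w |A u|^2] with [A] linear: the identity,
    or the increment [(h, x) |-> u (x + h) - u x] weighted by half the kernel
    [j (|h|)].  Such an energy is the diagonal of a sesquilinear form, and it is
    lower semicontinuous in [L^2] by Fatou's lemma along a sequence converging
    so fast that it converges almost everywhere.  As [|u|^2] is [L^2]-continuous,
    it remains to identify the set where [F] is finite with the form domain,
    and to show that this domain is dense.

    For the former, [K_rho z] is at most [C z^(-rho)] for all [z > 0], and at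
    least [c z^(-rho)] for bounded [z]; so [j r <= C r^(-d-alpha)] always and
    [j r >= c r^(-d-alpha)] for [r <= 1], while large increments are controlled
    by the [L^2] norm.  For the latter, compactly supported Lipschitz functions
    are in the domain because [alpha < 2] and [V] is locally integrable; the
    sets [{f > 0}], [f] Lipschitz, form a pi-system generating the Borel sets,
    so Dynkin's lemma approximates all indicator functions. *)

From HB Require Import structures.
Require Import Defs.
From mathcomp Require Import all_boot all_order all_algebra.
From mathcomp Require Import all_classical all_reals all_analysis.
From mathcomp Require Import measurable_realfun ess_sup_inf complex ring lra.

Import Order.TTheory GRing.Theory Num.Theory.
Import numFieldNormedType.Exports.

Local Open Scope classical_set_scope.
Local Open Scope ring_scope.

Set Implicit Arguments.
Unset Strict Implicit.
Unset Printing Implicit Defensive.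

(** * Lebesgue measure on tuples *)

Section lebesgue_tuples.
Context {R : realType}.

Definition cube (d : nat) (r : R) : set (d.-tuple R) :=
  [set x | forall i, `[- r, r]%classic (tnth x i)].

Lemma measurable_cube (d : nat) (r : R) : measurable (@cube d r).
Proof.
rewrite (_ : @cube d r = \bigcap_(i in [set: 'I_d])
    ((@tnth d R)^~ i @^-1` `[- r, r]%classic)).
  apply: fin_bigcap_measurable => //= i _; rewrite -[X in measurable X]setTI.
  by apply: measurable_tnth.
by apply/seteqP; split => x /= xA i; [move=> _; exact: xA|exact: xA].
Qed.

Lemma leb_cube (d : nat) (r : R) : 0 <= r ->
  leb R d (@cube d r) = ((2 * r) ^+ d)%:E.
Proof.
move=> r0; rewrite /cube (@leb_box R d (fun=> `[- r, r]%classic))//.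
under eq_bigr do rewrite lebesgue_measure_itv/= lte_fin.
rewrite [LHS](_ : _ = (\prod_(i < d) (2 * r)%:E)%E); last first.
  apply: eq_bigr => i _; case: ifPn => [_|]; first by rewrite -EFinD; congr (_%:E); ring.
  by rewrite -leNgt => rr; congr (_%:E); lra.
by rewrite prodEFin prodr_const card_ord.
Qed.

Lemma leb_sigma_finite (d : nat) : sigma_finite [set: d.-tuple R] (leb R d).
Proof.
exists (fun n => @cube d n%:R).
  apply/esym/seteqP; split => // x _.
  have [n hn] : exists n : nat, \sum_(i < d) `|tnth x i| <= n%:R.
    exists (Num.truncn (\sum_(i < d) `|tnth x i|)).+1; exact/ltW/truncnS_gt.
  exists n => //= i; rewrite /= in_itv/= -ler_norml (le_trans _ hn)//.
  by rewrite (bigD1 i)//= lerDl sumr_ge0.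
by move=> n; split; [exact: measurable_cube|rewrite leb_cube// ltry].
Qed.

(* [leb] is only packaged as a measure, whereas Fubini's theorem is stated for
   sigma-finite measures; [sleb d] is convertible to [leb R d]. *)
Definition slebf (d : nat) : set (d.-tuple R) -> \bar R := leb R d.

HB.instance Definition _ d := Measure.copy (@slebf d) (leb R d).

HB.instance Definition _ d := Measure_isSigmaFinite.Build _ _ _ (@slebf d)
  (@leb_sigma_finite d).

Definition sleb (d : nat) : {sigma_finite_measure set (d.-tuple R) -> \bar R} :=
  @slebf d.

Lemma measurable_tadd d d' (T : measurableType d') (f g : T -> d.-tuple R) :
  measurable_fun setT f -> measurable_fun setT g ->
  measurable_fun setT (fun x => tadd (f x) (g x)).
Proof.
move=> mf mg; apply/measurable_fun_tnthP => i.
rewrite (_ : _ \o _ = fun x => tnth (f x) i + tnth (g x) i); last first.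
  by apply/funext => x; rewrite /= tnth_mktuple.
by apply: measurable_funD; exact: (measurable_fun_tnthP _).1.
Qed.

Lemma measurable_enorm d : measurable_fun setT (@enorm R d).
Proof.
have ms : measurable_fun setT (@Num.sqrt R).
  apply: continuous_measurable_fun => x; exact: sqrt_continuous.
apply: measurableT_comp => //; apply: measurable_sum => i.
by apply: measurable_funX; exact: measurable_tnth.
Qed.

Lemma enorm_ge0 d (x : d.-tuple R) : 0 <= enorm x.
Proof. exact: sqrtr_ge0. Qed.

Lemma ler_tnth_enorm d (x : d.-tuple R) i : `|tnth x i| <= enorm x.
Proof.
rewrite -sqrtr_sqr ler_wsqrtr// (bigD1 i)//= lerDl sumr_ge0// => j _.
exact: sqr_ge0.
Qed.

Lemma leb_ball d (r : R) : 0 <= r ->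
  (leb R d [set x | (enorm x <= r)%R] <= ((2 * r) ^+ d)%:E)%E.
Proof.
move=> r0; rewrite -leb_cube//; apply: le_measure; rewrite ?inE.
- rewrite -[X in measurable X]setTI.
  apply: (measurable_fun_ler (f := @enorm R d) (g := cst r)) => //.
  exact: measurable_enorm.
- exact: measurable_cube.
- by move=> x /= xr i; rewrite /= in_itv/= -ler_norml (le_trans (ler_tnth_enorm x i)).
Qed.

Lemma lebesgue_measureD (a : R) (A : set R) : measurable A ->
  lebesgue_measure [set t | A (t + a)] = lebesgue_measure A.
Proof.
move=> mA.
have mD : measurable_fun setT (fun t : measurableTypeR R => (t + a : measurableTypeR R)).
  exact: measurable_funD.
change (pushforward lebesgue_measure
  (fun t : measurableTypeR R => (t + a : measurableTypeR R)) A =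
  lebesgue_measure A).
apply/esym/lebesgue_measure_unique => //= _ [[x y]] _ <-.
rewrite /pushforward (_ : _ @^-1` _ = `]x - a, y - a]%classic); last first.
  by apply/seteqP; split => t /=; rewrite !in_itv/= ltrBlDr lerBrDr.
rewrite !lebesgue_measure_itv/= !lte_fin ltrD2r; case: ifPn => // _.
by rewrite -!EFinD; congr (_%:E); ring.
Qed.

Lemma ge0_integral_translate_of (d : nat) (h : d.-tuple R) (f : d.-tuple R -> \bar R) :
  (forall A, measurable A -> leb R d [set x | A (tadd x h)] = leb R d A) ->
  measurable_fun setT f -> (forall x, 0 <= f x)%E ->
  (\int[leb R d]_x f (tadd x h) = \int[leb R d]_x f x)%E.
Proof.
move=> hA mf f0.
have mD : measurable_fun setT (fun x => tadd x h) by apply: measurable_tadd.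
rewrite -[LHS](ge0_integral_pushforward mD (leb R d) (D := setT) (f := f))//.
by apply: eq_measure_integral => A mA _; rewrite -hA.
Qed.

Lemma leb_translate (d : nat) (h : d.-tuple R) (A : set (d.-tuple R)) :
  measurable A -> leb R d [set x | A (tadd x h)] = leb R d A.
Proof.
elim: d h A => [|d IHd] h A mA; first by
  congr (leb R 0 _); apply/seteqP; split => x /=;
  rewrite [tadd x h]tuple0 [x]tuple0.
have [a [h' ->]] : exists a h', h = tcons (a, h').
  by exists (thead h), [tuple of behead h]; rewrite /tcons/= -tuple_eta.
have tDE t y : tadd (tcons (t, y)) (tcons (a, h')) = tcons (t + a, tadd y h').
  apply: eq_from_tnth => i; case: (unliftP ord0 i) => [j|] ->.
    by rewrite !(tnthS, tnth_mktuple).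
  by rewrite !(tnth0, tnth_mktuple).
have mB : measurable (tcons @^-1` A : set (R * d.-tuple R)).
  by rewrite -[X in measurable X]setTI; exact: measurable_tcons.
pose g y := lebesgue_measure (ysection (tcons @^-1` A) y) : \bar R.
change ((\int[leb R d]_y lebesgue_measure
   (ysection (tcons @^-1` [set x | A (tadd x (tcons (a, h')))]) y)) =
   \int[leb R d]_y g y)%E.
rewrite -(ge0_integral_translate_of (h := h') (f := g)) //.
- apply: eq_integral => y _; rewrite /g -[in RHS](lebesgue_measureD a);
    last exact: measurable_ysection.
  congr (lebesgue_measure _); apply/seteqP; split => t /=;
    by rewrite !ysectionE/= tDE.
- by move=> B mB'; exact: IHd.
- exact: measurable_fun_ysection.
Qed.

Lemma ge0_integral_translate (d : nat) (h : d.-tuple R) (f : d.-tuple R -> \bar R) :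
  measurable_fun setT f -> (forall x, 0 <= f x)%E ->
  (\int[leb R d]_x f (tadd x h) = \int[leb R d]_x f x)%E.
Proof. by apply: ge0_integral_translate_of => A; exact: leb_translate. Qed.

End lebesgue_tuples.

(** * Integrals of radial powers *)

Section shells.
Context d (T : measurableType d) {R : realType}.
Variables (mu : {measure set T -> \bar R}) (D : set T) (mD : measurable D).
Variables (N f : T -> R).
Hypothesis (mN : measurable_fun setT N) (mf : measurable_fun D f).
Hypothesis (f0 : forall x, D x -> 0 <= f x).

(* Covering by the balls [N <= r k]: on the k-th shell [f] is at most [c k], and
   [c k] times the measure of the k-th ball decays geometrically. *)
Lemma ge0_le_integral_geometric (c r : nat -> R) (K theta : R) :
  0 < theta < 1 -> 0 <= K -> (forall k, 0 <= c k) ->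
  (forall k, (c k)%:E * mu [set x | N x <= r k]%R <= (K * theta ^+ k)%:E)%E ->
  (forall x, D x -> f x != 0 -> exists k, f x <= c k /\ N x <= r k) ->
  (\int[mu]_(x in D) (f x)%:E <= (K / (1 - theta))%:E)%E.
Proof.
move=> /andP[t0 t1] K0 c0 cr fcr.
pose A k := [set x | N x <= r k].
have mA k : measurable (A k).
  rewrite -[X in measurable X]setTI.
  exact: (measurable_fun_ler mN (measurable_cst _)).
pose g k x := ((c k)%:E * (\1_(A k) x)%:E)%E : \bar R.
have mI k : measurable_fun D (fun x => (\1_(A k) x)%:E : \bar R).
  by apply/measurable_EFinP; exact: measurable_indic.
have mg k : measurable_fun D (g k).
  by rewrite /g; under eq_fun do rewrite -EFinM; apply/measurable_EFinP;
    apply: measurable_funM => //; exact: measurable_indic.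
have g0 k x : (0 <= g k x)%E by apply: mule_ge0; rewrite lee_fin ?c0.
apply: (@le_trans _ _ (\int[mu]_(x in D) (\sum_(k <oo) g k x))%E).
  apply: ge0_le_integral => //.
  - exact/measurable_EFinP.
  - exact: ge0_emeasurable_sum.
  - move=> x Dx; have [->|fx0] := eqVneq (f x) 0; first exact: nneseries_ge0.
    have [k [fk Nk]] := fcr _ Dx fx0.
    apply: le_trans (nneseries_lim_ge k.+1 _) => //.
    rewrite big_nat_recr//= -[leLHS]add0e leeD ?sume_ge0// /g indicE mem_set//.
    by rewrite mule1 lee_fin.
rewrite integral_nneseries//.
apply: lime_le; first by apply: is_cvg_nneseries => k _ _; exact: integral_ge0.
apply: nearW => n.
apply: (@le_trans _ _ (\sum_(0 <= k < n) (K * theta ^+ k)%:E)%E).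
  apply: lee_sum => k _; rewrite ge0_integralZl_EFin//.
  rewrite integral_indic//; apply: le_trans (cr k); rewrite lee_wpmul2l ?lee_fin//.
  by apply: le_measure; rewrite ?inE//; [exact: measurableI|exact: mA].
rewrite sumEFin lee_fin; apply: geometric_le_lim => //.
by rewrite ger0_norm// ltW.
Qed.

End shells.

Section power_integrals.
Context {R : realType}.

Lemma dyadic_floor (y : R) : 1 <= y -> exists k : nat, 2 ^+ k <= y <= 2 ^+ k.+1.
Proof.
move=> y1; have [m ym] : exists m, y <= 2 ^+ m.
  exists (Num.truncn y).+1; apply: (le_trans (ltW (truncnS_gt _))).
  by rewrite -natrX ler_nat ltnW// ltn_expl.
have ex : exists m, y <= 2 ^+ m by exists m.
case: (ex_minnP ex) => -[|k] yk kmin.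
  by exists 0%N; rewrite expr0 y1/= (le_trans yk)// expr0 expr1 ler1n.
exists k; rewrite yk andbT leNgt; apply/negP => /ltW /kmin.
by rewrite ltnn.
Qed.

Lemma le_powRN (a b s : R) : 0 <= s -> 0 < a -> a <= b -> b `^ (- s) <= a `^ (- s).
Proof.
move=> s0 a0 ab; rewrite !powRN lef_pV2 ?posrE ?powR_gt0 ?(lt_le_trans a0)//.
by rewrite ge0_ler_powR ?nnegrE// (le_trans (ltW a0)).
Qed.

Lemma powRE_gt0 (a s : R) : 0 < a -> a `^ s = expR (s * ln a).
Proof. by move=> a0; rewrite /powR gt_eqF. Qed.

Lemma powR2_lt1 (a : R) : a < 0 -> 0 < 2 `^ a < 1.
Proof.
move=> a0; rewrite powR_gt0//= powRE_gt0// -[ltRHS]expR0 ltr_expR.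
by rewrite nmulr_rlt0// ln_gt0// ltr1n.
Qed.

Lemma ln_expr (a : R) n : 0 < a -> ln (a ^+ n) = n%:R * ln a.
Proof. by move=> a0; rewrite -powR_mulrn ?ltW// ln_powR. Qed.

Section radial.
Context dd (T : measurableType dd) (mu : {measure set T -> \bar R}).
Variables (D : set T) (mD : measurable D) (N : T -> R).
Hypothesis mN : measurable_fun setT N.
Variables (C n : R).
Hypothesis C0 : 0 <= C.
Hypothesis growth : forall r, 0 < r ->
  (mu [set x | N x <= r]%R <= (C * r `^ n)%:E)%E.

Lemma integral_powRN_near0 (s w : R) : 0 <= s < n -> 0 < w ->
  (forall x, D x -> 0 < N x <= w) ->
  (\int[mu]_(x in D) (N x `^ (- s))%:E
    <= (C * 2 `^ s * w `^ (n - s) / (1 - 2 `^ (s - n)))%:E)%E.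
Proof.
move=> /andP[s0 sn] w0 DN.
have p2 k : 0 < 2 ^+ k :> R by rewrite exprn_gt0.
have P2 k : (2 ^+ k : R) \is Num.pos by rewrite posrE.
have P2V k : (2 ^- k : R) \is Num.pos by rewrite posrE invr_gt0.
apply: (@ge0_le_integral_geometric _ _ _ _ _ mD N _ mN _ _
  (fun k => (w / 2 ^+ k.+1) `^ (- s)) (fun k => w / 2 ^+ k)).
- apply: (measurableT_comp (measurable_powR _)) => //.
  exact: measurable_funS mN.
- by move=> x _; exact: powR_ge0.
- by apply: powR2_lt1; lra.
- by rewrite !mulr_ge0 ?powR_ge0.
- by move=> k; exact: powR_ge0.
- move=> k; apply: (@le_trans _ _
    (((w / 2 ^+ k.+1) `^ (- s))%:E * (C * (w / 2 ^+ k) `^ n)%:E)%E).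
    by rewrite lee_wpmul2l ?lee_fin ?powR_ge0// growth// divr_gt0.
  rewrite -EFinM lee_fin le_eqVlt; apply/orP; left; apply/eqP.
  rewrite mulrCA -!mulrA; congr (_ * _).
  rewrite !powRE_gt0 ?divr_gt0// -expRM_natl -!expRD; congr expR.
  rewrite !lnM// !lnV// !ln_expr// -natr1; ring.
- move=> x Dx _; have /andP[Nx0 Nw] := DN x Dx.
  have : 1 <= w / N x by rewrite ler_pdivlMr// mul1r.
  move=> /dyadic_floor[k /andP[k1 k2]]; exists k; split.
    apply: le_powRN => //; first by rewrite divr_gt0.
    by rewrite ler_pdivrMr// mulrC -ler_pdivrMr.
  by rewrite ler_pdivlMr// mulrC -ler_pdivlMr.
Qed.

Lemma integral_powRN_infty (s w : R) : 0 <= s -> n < s -> 0 < w ->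
  (forall x, D x -> w <= N x) ->
  (\int[mu]_(x in D) (N x `^ (- s))%:E
    <= (C * 2 `^ n * w `^ (n - s) / (1 - 2 `^ (n - s)))%:E)%E.
Proof.
move=> s0 sn w0 DN.
have p2 k : 0 < 2 ^+ k :> R by rewrite exprn_gt0.
have P2 k : (2 ^+ k : R) \is Num.pos by rewrite posrE.
apply: (@ge0_le_integral_geometric _ _ _ _ _ mD N _ mN _ _
  (fun k => (w * 2 ^+ k) `^ (- s)) (fun k => w * 2 ^+ k.+1)).
- apply: (measurableT_comp (measurable_powR _)) => //.
  exact: measurable_funS mN.
- by move=> x _; exact: powR_ge0.
- by apply: powR2_lt1; lra.
- by rewrite !mulr_ge0 ?powR_ge0.
- by move=> k; exact: powR_ge0.
- move=> k; apply: (@le_trans _ _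
    (((w * 2 ^+ k) `^ (- s))%:E * (C * (w * 2 ^+ k.+1) `^ n)%:E)%E).
    by rewrite lee_wpmul2l ?lee_fin ?powR_ge0// growth// mulr_gt0.
  rewrite -EFinM lee_fin le_eqVlt; apply/orP; left; apply/eqP.
  rewrite mulrCA -!mulrA; congr (_ * _).
  rewrite !powRE_gt0 ?mulr_gt0// -expRM_natl -!expRD; congr expR.
  rewrite !lnM// !ln_expr// -natr1; ring.
- move=> x Dx _; have wN := DN x Dx.
  have : 1 <= N x / w by rewrite ler_pdivlMr// mul1r.
  move=> /dyadic_floor[k /andP[k1 k2]]; exists k; split.
    apply: le_powRN => //; first by rewrite mulr_gt0.
    by rewrite mulrC -ler_pdivlMr.
  by rewrite mulrC -ler_pdivrMr.
Qed.

End radial.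
End power_integrals.

(** * Gamma and Bessel functions, and the jump kernel *)

Section special_function_bounds.
Context {R : realType}.
Local Notation leb1 := (@lebesgue_measure R).

Lemma Rintegral_between d (T : measurableType d) (mu : {measure set T -> \bar R})
    (D : set T) (f : T -> R) (c C : R) :
  (c%:E <= \int[mu]_(x in D) (f x)%:E <= C%:E)%E ->
  c <= Rintegral mu D f <= C.
Proof.
move=> /andP[cf fC]; rewrite /Rintegral.
have fin : (\int[mu]_(x in D) (f x)%:E)%E \is a fin_num.
  by rewrite fin_numE gt_eqF ?(lt_le_trans (ltNyr c))// lt_eqF ?(le_lt_trans fC)// ltry.
by rewrite -2!lee_fin fineK// cf fC.
Qed.

Lemma le_integral_scale d (T : measurableType d) (mu : {measure set T -> \bar R})
    (D : set T) (f g : T -> R) (K M : R) : measurable D ->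
  measurable_fun D f -> measurable_fun D g -> 0 <= K ->
  (forall x, D x -> 0 <= g x) ->
  (forall x, D x -> 0 <= f x <= K * g x) ->
  (\int[mu]_(x in D) (g x)%:E <= M%:E)%E ->
  (\int[mu]_(x in D) (f x)%:E <= (K * M)%:E)%E.
Proof.
move=> mD mf mg K0 g0 fg gM.
apply: (@le_trans _ _ (\int[mu]_(x in D) (K%:E * (g x)%:E))%E).
  apply: ge0_le_integral => //; try by apply/measurable_EFinP.
  - by move=> x Dx; rewrite lee_fin; case/andP: (fg _ Dx).
  - under eq_fun do rewrite -EFinM.
    by apply/measurable_EFinP; apply: measurable_funM.
  - by move=> x Dx; rewrite lee_fin; case/andP: (fg _ Dx).
rewrite ge0_integralZl_EFin//; last exact/measurable_EFinP.
by rewrite EFinM lee_wpmul2l// lee_fin.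
Qed.

Lemma powRDgt0 (x a b : R) : 0 < x -> x `^ (a + b) = x `^ a * x `^ b.
Proof. by move=> x0; rewrite powRD// (gt_eqF x0) implybT. Qed.

Lemma powR_le_expR (a : R) : exists2 K, 0 < K & forall x, 1 <= x -> x `^ a <= K * expR x.
Proof.
pose n := Num.truncn a.
exists (n.+1)`!%:R; first by rewrite ltr0n fact_gt0.
move=> x x1; have x0 : 0 <= x by rewrite (le_trans _ x1).
apply: (@le_trans _ _ (x ^+ n.+1)).
  by rewrite -powR_mulrn// ler_powR// ltW// truncnS_gt.
rewrite -ler_pdivrMl ?ltr0n ?fact_gt0// mulrC.
by rewrite (le_trans _ (expR_ge1Dxn n x0))// lerDr.
Qed.

Lemma measurable_inv : measurable_fun setT (@GRing.inv R).
Proof.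
rewrite (_ : GRing.inv = fun x : R => x * (x ^+ 2) `^ (- 1)).
  apply: measurable_funM => //.
  by apply: (measurableT_comp (measurable_powR _)) => //; exact: measurable_funX.
apply/funext => x; rewrite powR_inv1 ?sqr_ge0// expr2.
have [->|x0] := eqVneq x 0; first by rewrite invr0 mul0r.
by rewrite invfM mulrA divff// mul1r.
Qed.

Lemma ball1_growth (r : R) : 0 < r ->
  (leb1 [set x | (`|x| <= r)%R] <= (2 * r `^ 1)%:E)%E.
Proof.
move=> r0; rewrite (_ : [set x | _] = `[- r, r]%classic); last first.
  by apply/seteqP; split => x /=; rewrite in_itv/= ler_norml.
have rr : - r < r by lra.
by rewrite lebesgue_measure_itv/= lte_fin rr (powRr1 (ltW r0)) -EFinB lee_fin; lra.
Qed.

Lemma integral_powRN_0w (s w : R) : 0 <= s < 1 -> 0 < w ->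
  (\int[leb1]_(t in `]0%R, w]) (t `^ (- s))%:E
    <= (2 * 2 `^ s * w `^ (1 - s) / (1 - 2 `^ (s - 1)))%:E)%E.
Proof.
move=> s01 w0.
have D0 t : `]0, w]%classic t -> 0 < `|t| <= w.
  by rewrite /= in_itv/= => /andP[t0 tw]; rewrite gtr0_norm// t0.
apply: le_trans (@integral_powRN_near0 R _ _ leb1 `]0, w]%classic
  (measurable_itv _) (fun t : R => `|t|) (@normr_measurable R setT) 2 1
  (ler0n R 2) ball1_growth s w s01 w0 D0).
rewrite le_eqVlt; apply/orP; left; apply/eqP.
apply: eq_integral => t /[!inE] /=; rewrite in_itv/= => /andP[t0 _].
by rewrite ger0_norm// ltW.
Qed.

Lemma integral_powRN_wy (s w : R) : 1 < s -> 0 < w ->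
  (\int[leb1]_(t in `]w, +oo[) (t `^ (- s))%:E
    <= (2 * 2 `^ 1 * w `^ (1 - s) / (1 - 2 `^ (1 - s)))%:E)%E.
Proof.
move=> s1 w0.
have D0 t : `]w, +oo[%classic t -> w <= `|t|.
  by rewrite /= in_itv/= andbT => tw; rewrite gtr0_norm ?(lt_trans w0)// ltW.
have s0 : 0 <= s by lra.
apply: le_trans (@integral_powRN_infty R _ _ leb1 `]w, +oo[%classic
  (measurable_itv _) (fun t : R => `|t|) (@normr_measurable R setT) 2 1
  (ler0n R 2) ball1_growth s w s0 s1 w0 D0).
rewrite le_eqVlt; apply/orP; left; apply/eqP.
apply: eq_integral => t /[!inE] /=; rewrite in_itv/= andbT => tw.
by rewrite gtr0_norm// (lt_trans w0).
Qed.

Lemma ge0_integral_halfline_split (f : R -> R) (w : R) : 0 < w ->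
  measurable_fun (`]0, +oo[%classic : set R) f -> (forall t, 0 < t -> 0 <= f t) ->
  (\int[leb1]_(t in `]0%R, +oo[) (f t)%:E =
   \int[leb1]_(t in `]0%R, w]) (f t)%:E + \int[leb1]_(t in `]w, +oo[) (f t)%:E)%E.
Proof.
move=> w0 mf f0.
have E : `]0, +oo[%classic = `]0, w]%classic `|` `]w, +oo[%classic :> set R.
  apply/seteqP; split => t /=; rewrite !in_itv/= !andbT.
    by move=> ->; case: (leP t w); [left|right].
  by case=> [/andP[]//|]; exact: lt_trans.
rewrite E ge0_integral_setU//.
- by rewrite -E; exact/measurable_EFinP.
- by rewrite -E => t /=; rewrite in_itv/= andbT lee_fin => /f0.
- apply/disj_setPS => t /= []; rewrite !in_itv/= andbT => /andP[_ tw].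
  by rewrite ltNge tw.
Qed.

Lemma integral_halfline_ge (f : R -> R) (a b c : R) : 0 < a <= b ->
  measurable_fun (`]0, +oo[%classic : set R) f -> (forall t, 0 < t -> 0 <= f t) ->
  (forall t, a <= t <= b -> c <= f t) -> 0 <= c ->
  ((c * (b - a))%:E <= \int[leb1]_(t in `]0%R, +oo[) (f t)%:E)%E.
Proof.
move=> /andP[a0 ab] mf f0 cf c0.
have sub : `[a, b]%classic `<=` `]0, +oo[%classic.
  by move=> t /=; rewrite !in_itv/= andbT => /andP[at0 _]; exact: lt_le_trans at0.
apply: (@le_trans _ _ (\int[leb1]_(t in `[a, b]) (f t)%:E)%E); last first.
  apply: ge0_subset_integral => //; first exact/measurable_EFinP.
  by move=> t /=; rewrite in_itv/= andbT lee_fin => /f0.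
apply: (@le_trans _ _ (\int[leb1]_(t in `[a, b]) (cst c%:E t))%E).
  rewrite integral_cst//= lebesgue_measure_itv/= lte_fin.
  move: ab; rewrite le_eqVlt => /predU1P[->|ab].
    by rewrite ltxx mule0 subrr mulr0.
  by rewrite ab -EFinB -EFinM.
by apply: ge0_le_integral => //; apply/measurable_EFinP; exact: measurable_funS mf.
Qed.

Lemma measurable_powR_expR (D : set R) (a : R) (g : R -> R) :
  measurable_fun D g -> measurable_fun D (fun t => t `^ a * expR (g t)).
Proof.
move=> mg; apply: measurable_funM; first by apply: measurable_funTS; exact: measurable_powR.
exact: (measurableT_comp (@measurable_expR R)).
Qed.

Lemma gamma_int_gt0 (x : R) : 0 < x -> 0 < gamma_int x.
Proof.
move=> x0; pose f t := t `^ (x - 1) * expR (- t).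
have mf D : measurable_fun D f.
  by apply: measurable_powR_expR; apply/measurable_funTS.
have f0 t : 0 <= f t by rewrite mulr_ge0 ?powR_ge0 ?expR_ge0.
have [K K0 powK] := powR_le_expR (x + 1).
pose b := Num.max (1 - x) 0.
have b01 : 0 <= b < 1 by rewrite le_max lexx orbT/= gt_max ltr01 andbT; lra.
have bx : 1 - x <= b by rewrite le_max lexx.
have [M1 fM1] : exists M, (\int[leb1]_(t in `]0%R, 1%R]) (f t)%:E <= M%:E)%E.
  eexists; apply: (@le_integral_scale _ _ leb1 `]0, 1]%classic f (fun t => t `^ (- b)) 1).
  - by [].
  - exact: mf.
  - by apply: measurable_funTS; exact: measurable_powR.
  - by [].
  - by move=> t _; exact: powR_ge0.
  - move=> t /=; rewrite in_itv/= => /andP[t0 t1]; rewrite f0 mul1r /f.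
    rewrite -[leRHS]mulr1 ler_pM ?powR_ge0 ?expR_ge0//; last by rewrite -expR0 ler_expR; lra.
    rewrite !powRE_gt0// ler_expR ler_wnM2r//; first by rewrite ln_le0.
    by lra.
  - exact: integral_powRN_0w.
have [M2 fM2] : exists M, (\int[leb1]_(t in `]1%R, +oo[) (f t)%:E <= M%:E)%E.
  eexists; apply: (@le_integral_scale _ _ leb1 `]1, +oo[%classic f (fun t => t `^ (- 2)) K).
  - by [].
  - exact: mf.
  - by apply: measurable_funTS; exact: measurable_powR.
  - exact: ltW.
  - by move=> t _; exact: powR_ge0.
  - move=> t /=; rewrite in_itv/= andbT => t1; rewrite f0/= /f.
    have t0 : 0 < t by lra.
    rewrite expRN ler_pdivrMr ?expR_gt0// (_ : x - 1 = (x + 1) - 2); last ring.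
    rewrite powRDgt0//.
    by rewrite mulrC -mulrA mulrCA ler_wpM2l ?powR_ge0// powK// ltW.
  - by apply: integral_powRN_wy => //; lra.
pose c := expR (- (`|x - 1| * ln 2) - 2).
have c0 : 0 < c by exact: expR_gt0.
have [| cg _] := andP (@Rintegral_between _ _ leb1 `]0, +oo[%classic f
  (c * (2 - 1)) (M1 + M2) _).
  rewrite integral_halfline_ge//=.
  - by rewrite (@ge0_integral_halfline_split f 1)// EFinD leeD.
  - by apply/andP; split; lra.
  - move=> t /andP[t1 t2]; rewrite /c /f powRE_gt0; last lra.
    rewrite -expRD ler_expR.
    have : `|(x - 1) * ln t| <= `|x - 1| * ln 2.
      rewrite normrM ler_wpM2l// ger0_norm ?ln_ge0// ler_ln ?posrE//; lra.
    by rewrite ler_norml => /andP[h _]; lra.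
  - exact: ltW.
by apply: lt_le_trans cg; rewrite mulr_gt0//; lra.
Qed.

Let besselF (rho z t : R) := t `^ (- rho - 1) * expR (- t - z ^+ 2 / (4 * t)).

Let besselF_ge0 rho z t : 0 <= besselF rho z t.
Proof. by rewrite mulr_ge0 ?powR_ge0 ?expR_ge0. Qed.

Lemma measurable_bessel_integrand rho :
  measurable_fun setT (fun p : R * R => besselF rho p.1 p.2).
Proof.
apply: measurable_funM.
  by apply: (measurableT_comp (measurable_powR _)).
apply: (measurableT_comp (@measurable_expR R)).
apply: measurable_funB; first exact: measurableT_comp.
apply: measurable_funM; first exact: measurable_funX.
by apply: (measurableT_comp measurable_inv); exact: measurable_funM.
Qed.

Let mbesselF rho z D : measurable_fun D (besselF rho z).
Proof.
apply/measurable_funTS.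
exact: (measurableT_comp (measurable_bessel_integrand rho) (measurable_pair1 z)).
Qed.

Lemma measurable_besselK rho : measurable_fun setT (@besselK R rho).
Proof.
apply: measurable_funM.
  apply: measurable_funM => //; apply: (measurableT_comp (measurable_powR _)).
  exact: measurable_funM.
suff mI : measurable_fun setT
    (fun z : R => (\int[leb1]_(t in `]0%R, +oo[) (besselF rho z t)%:E)%E).
  exact: (measurableT_comp (@fine_measurable R setT measurableT) mI).
pose F (p : R * R) := (besselF rho p.1 p.2 * \1_(`]0, +oo[%classic) p.2)%:E.
rewrite (_ : (fun z => _) = fun z => (\int[leb1]_t F (z, t))%E); last first.
  apply/funext => z; rewrite integral_mkcond; apply: eq_integral => t _.
  by rewrite patchE /F indicE /besselF/=; case: ifPn; rewrite (mulr1, mulr0).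
apply: (@measurable_fun_fubini_tonelli_F _ _ _ _ R leb1 F).
  apply/measurable_EFinP; apply: measurable_funM.
    exact: measurable_bessel_integrand.
  by apply: (@measurableT_comp _ _ _ _ _ _ (\1_(`]0, +oo[%classic) : R -> R)) => //;
    exact: measurable_indic.
by move=> p; rewrite lee_fin mulr_ge0.
Qed.

Lemma besselK_ge0 (rho z : R) : 0 <= besselK rho z.
Proof.
rewrite !mulr_ge0 ?powR_ge0// ?invr_ge0//; apply: Rintegral_ge0 => t _.
exact: besselF_ge0.
Qed.

Lemma besselK_bounds (rho z0 : R) : 0 < rho ->
  exists c C, [/\ 0 < c, 0 < C,
    forall z, 0 < z -> besselK rho z <= C * z `^ (- rho) &
    forall z, 0 < z <= z0 -> c * z `^ (- rho) <= besselK rho z].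
Proof.
move=> rho0.
have [K K0 powK] := powR_le_expR (rho + 1).
have zw (z : R) : z ^+ 2 / 4 = (z / 2) ^+ 2 by field.
have [M M0 upper] : exists2 M, 0 < M & forall z, 0 < z ->
    (\int[leb1]_(t in `]0%R, +oo[) (besselF rho z t)%:E <=
     (M * ((z / 2) ^+ 2) `^ (- rho))%:E)%E.
  pose L := 2 * 2 `^ 1 / (1 - 2 `^ (1 - (rho + 1))) : R.
  have L0 : 0 < L.
    rewrite divr_gt0 ?mulr_gt0 ?powR_gt0//.
    have /andP[_] : 0 < (2 : R) `^ (1 - (rho + 1)) < 1 by apply: powR2_lt1; lra.
    lra.
  (* The integrand is at most [K w^(-rho-1)] for [t <= w := (z/2)^2], since
     [x^(rho+1) <= K e^x] at [x = w/t >= 1], and at most [t^(-rho-1)] beyond. *)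
  exists (K + L); first exact: addr_gt0.
  move=> z z0'; set w := (z / 2) ^+ 2.
  have w0 : 0 < w by rewrite exprn_gt0// divr_gt0.
  have le1 t : 0 < t -> besselF rho z t <= t `^ (- rho - 1) * expR (- (w / t)).
    move=> t0; rewrite ler_wpM2l ?powR_ge0// ler_expR.
    rewrite (_ : z ^+ 2 / (4 * t) = w / t) /w; last by field; rewrite gt_eqF.
    lra.
  rewrite (@ge0_integral_halfline_split (besselF rho z) w)//.
  rewrite mulrDl EFinD leeD//.
    apply: (@le_trans _ _ (\int[leb1]_(t in `]0%R, w]) (cst (K * w `^ (- rho - 1))%:E t))%E).
      apply: ge0_le_integral => //.
      - by move=> t _; rewrite lee_fin.
      - by apply/measurable_EFinP; exact: mbesselF.
      - move=> t /=; rewrite in_itv/= => /andP[t0 tw]; rewrite lee_fin.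
        apply: (le_trans (le1 _ t0)).
        have x1 : 1 <= w / t by rewrite ler_pdivlMr// mul1r.
        rewrite expRN ler_pdivrMr ?expR_gt0// mulrAC.
        apply: le_trans (ler_wpM2r (powR_ge0 w (- rho - 1)) (powK _ x1)).
        rewrite le_eqVlt; apply/orP; left; apply/eqP.
        rewrite !powRE_gt0// ?divr_gt0// -expRD; congr expR.
        by rewrite lnM ?lnV ?posrE ?invr_gt0//; ring.
    rewrite integral_cst//= lebesgue_measure_itv/= lte_fin w0 -EFinB -EFinM lee_fin.
    rewrite subr0 -mulrA (ler_wpM2l (ltW K0))// le_eqVlt; apply/orP; left; apply/eqP.
    by rewrite -{2}(powRr1 (ltW w0)) -powRDgt0//; congr (_ `^ _); ring.
  apply: (@le_trans _ _ (1 * (2 * 2 `^ 1 * w `^ (1 - (rho + 1)) /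
      (1 - 2 `^ (1 - (rho + 1)))))%:E).
    apply: (@le_integral_scale _ _ leb1 `]w, +oo[%classic _
      (fun t => t `^ (- (rho + 1)))) => //.
    - exact: mbesselF.
    - by apply: measurable_funTS; exact: measurable_powR.
    - by move=> t _; exact: powR_ge0.
    - move=> t /=; rewrite in_itv/= andbT => wt; have t0 := lt_trans w0 wt.
      rewrite besselF_ge0/= mul1r (le_trans (le1 _ t0))//.
      rewrite opprD -[leRHS]mulr1 ler_wpM2l ?powR_ge0// -expR0 ler_expR.
      by rewrite oppr_le0 divr_ge0 ?ltW.
    - by apply: integral_powRN_wy => //; lra.
  rewrite lee_fin le_eqVlt; apply/orP; left; apply/eqP.
  by rewrite mul1r /L (_ : 1 - (rho + 1) = - rho) 1?mulrAC//; ring.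
pose w1 := (z0 / 2) ^+ 2.
pose c := 2 `^ (- rho - 1) * expR (- (2 * w1) - 1).
have c0 : 0 < c by rewrite mulr_gt0 ?powR_gt0 ?expR_gt0.
(* For the lower bound it suffices to integrate over [w, 2w]. *)
have lower z : 0 < z <= z0 ->
    ((c * ((z / 2) ^+ 2) `^ (- rho))%:E <=
     \int[leb1]_(t in `]0%R, +oo[) (besselF rho z t)%:E)%E.
  move=> /andP[zp zz0]; set w := (z / 2) ^+ 2.
  have w0 : 0 < w by rewrite exprn_gt0// divr_gt0.
  have ww1 : w <= w1 by rewrite lerXn2r ?nnegrE; lra.
  have := @integral_halfline_ge (besselF rho z) w (2 * w)
    ((2 * w) `^ (- rho - 1) * expR (- (2 * w1) - 1)).
  move=> /(_ _ _ _ _ _)/(le_trans _); apply.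
  - rewrite lee_fin le_eqVlt; apply/orP; left; apply/eqP.
    rewrite (_ : 2 * w - w = w); last ring.
    have wE : w `^ (- rho) = w `^ (- rho - 1) * w.
      by rewrite -[X in _ * X](powRr1 (ltW w0)) -powRDgt0//; congr (_ `^ _); ring.
    by rewrite wE (powRM _ (ler0n R 2) (ltW w0)) /c; ring.
  - by apply/andP; split; lra.
  - exact: mbesselF.
  - by move=> t _; exact: besselF_ge0.
  - move=> t /andP[wt t2w]; have t0 := lt_le_trans w0 wt.
    rewrite ler_pM ?powR_ge0 ?expR_ge0//.
      by rewrite -opprD; apply: le_powRN => //; lra.
    rewrite ler_expR (_ : z ^+ 2 / (4 * t) = w / t) /w; last by field; rewrite gt_eqF.
    have : w / t <= 1 by rewrite ler_pdivrMr// mul1r.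
    rewrite -/w; lra.
  - by rewrite mulr_ge0 ?powR_ge0 ?expR_ge0.
have zE z : 0 < z -> 2^-1 * (z / 2) `^ rho * ((z / 2) ^+ 2) `^ (- rho) =
    2 `^ (rho - 1) * z `^ (- rho).
  move=> zp; have h : 2^-1 = expR (- ln 2) :> R by rewrite expRN lnK ?posrE.
  rewrite [X in X * _ * _ = _]h !powRE_gt0 ?exprn_gt0 ?divr_gt0// -!expRD; congr expR.
  by rewrite ln_expr ?divr_gt0// lnM ?lnV ?posrE ?invr_gt0//; ring.
have P0 : 0 < 2 `^ (rho - 1) :> R by rewrite powR_gt0.
exists (2 `^ (rho - 1) * c), (2 `^ (rho - 1) * M).
split; [exact: mulr_gt0|exact: mulr_gt0| |].
- move=> z zp; rewrite [leRHS]mulrAC -zE// [leRHS]mulrAC -[leRHS]mulrA /besselK.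
  rewrite ler_wpM2l ?mulr_ge0 ?powR_ge0 ?invr_ge0//.
  have [|_ //] := andP (@Rintegral_between _ _ leb1 `]0, +oo[%classic (besselF rho z)
    0 (M * ((z / 2) ^+ 2) `^ (- rho)) _).
  rewrite upper// andbT; apply: integral_ge0 => t _; rewrite lee_fin; exact: besselF_ge0.
- move=> z /andP[zp zz0]; rewrite [leLHS]mulrAC -zE// [leLHS]mulrAC -[leLHS]mulrA /besselK.
  rewrite ler_wpM2l ?mulr_ge0 ?powR_ge0 ?invr_ge0//.
  have [|//] := andP (@Rintegral_between _ _ leb1 `]0, +oo[%classic (besselF rho z)
    (c * ((z / 2) ^+ 2) `^ (- rho)) (M * ((z / 2) ^+ 2) `^ (- rho)) _).
  by rewrite upper// andbT lower// zp.
Qed.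

End special_function_bounds.

Section jkernel_bounds.
Context {R : realType} (d : nat) (m alpha : R).
Hypotheses (m0 : 0 <= m) (al0 : 0 < alpha) (al2 : alpha < 2).

Let rho0 : 0 < (d%:R + alpha) / 2.
Proof. by rewrite divr_gt0// ltr_wpDl. Qed.

Lemma gamma_gt0 (x : R) : 0 < x -> 0 < gamma x.
Proof. by move=> x0; rewrite /gamma x0 gamma_int_gt0. Qed.

Lemma gammaN_neq0 (x : R) : 0 < x < 1 -> gamma (- x) != 0.
Proof.
move=> /andP[x0 x1]; rewrite /gamma oppr_gt0 ltNge (ltW x0)/= opprK.
have -> : Num.truncn x = 0%N by apply/truncn0Pn; rewrite -ltNge.
rewrite big_ord1 addr0 mulf_neq0 ?invr_eq0 ?oppr_eq0 ?gt_eqF//.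
by apply: gamma_int_gt0; lra.
Qed.

Lemma jkernel_bounds : exists c C, [/\ 0 < c, 0 < C,
  forall r, 0 < r -> jkernel d m alpha r <= C * r `^ (- (d%:R + alpha)) &
  forall r, 0 < r <= 1 -> c * r `^ (- (d%:R + alpha)) <= jkernel d m alpha r].
Proof.
rewrite /jkernel; have [mE|mN0] := eqVneq m 0.
  set A := _ / (_ * _).
  have A0 : 0 < A.
    rewrite divr_gt0 ?mulr_gt0 ?powR_gt0 ?pi_gt0 ?gamma_gt0 ?normr_gt0//.
  by apply: gammaN_neq0; rewrite divr_gt0//= ltr_pdivrMr// mul1r.
  by exists A, A; split => // r _; rewrite opprD.
have mp : 0 < m by rewrite lt_neqAle eq_sym mN0.
set A := _ / (_ * _).
have A0 : 0 < A.
  by rewrite divr_gt0 ?mulr_gt0 ?powR_gt0 ?pi_gt0 ?gamma_gt0//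
    subr_gt0 ltr_pdivrMr// mul1r.
set k := m `^ alpha^-1; have k0 : 0 < k by rewrite powR_gt0.
set rho := (d%:R + alpha) / 2.
have [c [C [c0 C0 up low]]] := @besselK_bounds R rho k rho0.
have kE r : 0 < r -> r `^ (- (d%:R + alpha)) * k `^ (- rho) = (k * r) `^ (- rho) / r `^ rho.
  move=> r0; rewrite -powRN (_ : - (d%:R + alpha) = - rho + - rho);
    last by rewrite /rho; field.
  by rewrite powRDgt0// [in RHS]powRM ?ltW//; ring.
exists (A * (c * k `^ (- rho))), (A * (C * k `^ (- rho))); split.
- by apply: mulr_gt0 => //; apply: mulr_gt0 => //; exact: powR_gt0.
- by apply: mulr_gt0 => //; apply: mulr_gt0 => //; exact: powR_gt0.
- move=> r r0; rewrite -[leRHS]mulrA (ler_wpM2l (ltW A0))// -[leRHS]mulrA.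
  rewrite [k `^ _ * _]mulrC kE// [leRHS]mulrA.
  by rewrite ler_wpM2r ?invr_ge0 ?powR_ge0// up// mulr_gt0.
- move=> r /andP[r0 r1]; rewrite -[leLHS]mulrA (ler_wpM2l (ltW A0))// -[leLHS]mulrA.
  rewrite [k `^ _ * _]mulrC kE// [leLHS]mulrA.
  rewrite ler_wpM2r ?invr_ge0 ?powR_ge0// low// mulr_gt0//=.
  by rewrite -[leRHS]mulr1 (ler_wpM2l (ltW k0)).
Qed.

Lemma jkernel_ge0 r : 0 <= jkernel d m alpha r.
Proof.
rewrite /jkernel; case: ifPn => _.
  rewrite mulr_ge0 ?powR_ge0// divr_ge0 ?mulr_ge0 ?powR_ge0//.
  exact/ltW/gamma_gt0.
apply: mulr_ge0; last by apply: divr_ge0; [exact: besselK_ge0|exact: powR_ge0].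
rewrite divr_ge0 ?mulr_ge0 ?powR_ge0// ?ltW//.
by apply: gamma_gt0; rewrite subr_gt0 ltr_pdivrMr// mul1r.
Qed.

Lemma measurable_jkernel : measurable_fun setT (jkernel d m alpha).
Proof.
rewrite /jkernel; have [_|_] := eqVneq m 0.
  by apply: measurable_funM => //; exact: (@measurable_powR R).
apply: measurable_funM => //; apply: measurable_funM.
  by apply: (measurableT_comp (@measurable_besselK R _)).
by apply: (measurableT_comp (@measurable_inv R)); exact: (@measurable_powR R).
Qed.

End jkernel_bounds.

(** * Weighted energies and their sesquilinear forms *)

Section complex_coordinates.
Context {R : realType}.
Local Notation C := R[i].
Implicit Types z w : C.

Lemma conjcE z : z^* = (complex.Re z +i* - complex.Im z)%C.
Proof. by case: z. Qed.

Lemma mulcE z w : z * w =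
  ((complex.Re z * complex.Re w - complex.Im z * complex.Im w) +i*
   (complex.Re z * complex.Im w + complex.Im z * complex.Re w))%C.
Proof. by case: z => a b; case: w. Qed.

Lemma addcE z w : z + w =
  ((complex.Re z + complex.Re w) +i* (complex.Im z + complex.Im w))%C.
Proof. by case: z => a b; case: w. Qed.

Lemma oppcE z : - z = ((- complex.Re z) +i* (- complex.Im z))%C.
Proof. by case: z. Qed.

Lemma cabs_sqr z : cabs z ^+ 2 = complex.Re z ^+ 2 + complex.Im z ^+ 2.
Proof.
by rewrite /cabs normc_def/= sqr_sqrtr// addr_ge0// sqr_ge0.
Qed.

Lemma cabs_ge0 z : 0 <= cabs z.
Proof. by rewrite /cabs normc_def/= sqrtr_ge0. Qed.

Lemma cabs0 : cabs (0 : C) = 0.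
Proof. by rewrite /cabs normr0. Qed.

Lemma cabsN z : cabs (- z) = cabs z.
Proof. by rewrite /cabs normrN. Qed.

Lemma cabs_sqrD (e : R) z w : 0 < e ->
  cabs (z + w) ^+ 2 <= (1 + e) * cabs z ^+ 2 + (1 + e^-1) * cabs w ^+ 2.
Proof.
move=> e0; rewrite !cabs_sqr addcE/= -subr_ge0 (_ : _ - _ =
  e * ((complex.Re z - complex.Re w / e) ^+ 2 + (complex.Im z - complex.Im w / e) ^+ 2)).
  by rewrite mulr_ge0 ?(ltW e0)// addr_ge0// sqr_ge0.
by field; rewrite gt_eqF.
Qed.

Lemma cabs_sqrM z w : cabs (z * w) ^+ 2 = cabs z ^+ 2 * cabs w ^+ 2.
Proof. by rewrite !cabs_sqr mulcE/=; ring. Qed.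

End complex_coordinates.

Section weighted_energy.
Context dT (T : measurableType dT) {R : realType}.
Local Notation C := R[i].
Implicit Types (f g h : T -> C).

Definition cmeasurable f :=
  measurable_fun setT (fun x => complex.Re (f x)) /\
  measurable_fun setT (fun x => complex.Im (f x)).

Lemma cmeasurableD f g : cmeasurable f -> cmeasurable g ->
  cmeasurable (fun x => f x + g x).
Proof.
move=> [fr fi] [gr gi]; split.
  by under eq_fun do rewrite addcE/=; exact: measurable_funD.
by under eq_fun do rewrite addcE/=; exact: measurable_funD.
Qed.

Lemma cmeasurableN f : cmeasurable f -> cmeasurable (fun x => - f x).
Proof.
move=> [fr fi]; split.
  by under eq_fun do rewrite oppcE/=; exact: measurableT_comp.
by under eq_fun do rewrite oppcE/=; exact: measurableT_comp.
Qed.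

Lemma cmeasurableZ (a : C) f : cmeasurable f -> cmeasurable (fun x => a * f x).
Proof.
move=> [fr fi]; split.
  under eq_fun do rewrite mulcE/=.
  by apply: measurable_funB; exact: measurable_funM.
under eq_fun do rewrite mulcE/=.
by apply: measurable_funD; exact: measurable_funM.
Qed.

Lemma measurable_cabs_sqr f : cmeasurable f ->
  measurable_fun setT (fun x => cabs (f x) ^+ 2).
Proof.
move=> [fr fi]; under eq_fun do rewrite cabs_sqr.
by apply: measurable_funD; exact: measurable_funX.
Qed.

Variables (mu : {measure set T -> \bar R}) (w : T -> R).
Hypotheses (w0 : forall x, 0 <= w x) (mw : measurable_fun setT w).

Definition energy f : \bar R := (\int[mu]_x (w x * cabs (f x) ^+ 2)%:E)%E.

Definition finite_energy f := cmeasurable f /\ (energy f < +oo)%E.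

Lemma measurable_energy_density f : cmeasurable f ->
  measurable_fun setT (fun x => (w x * cabs (f x) ^+ 2)%:E).
Proof.
move=> mf; apply/measurable_EFinP; apply: measurable_funM => //.
exact: measurable_cabs_sqr.
Qed.

Lemma energy_density_ge0 f x : (0 <= (w x * cabs (f x) ^+ 2)%:E)%E.
Proof. by rewrite lee_fin mulr_ge0// sqr_ge0. Qed.

Lemma energy_ge0 f : (0 <= energy f)%E.
Proof. by apply: integral_ge0 => x _; exact: energy_density_ge0. Qed.

Lemma energyD_scaled (e : R) f g : 0 < e -> cmeasurable f -> cmeasurable g ->
  (energy (fun x => (f x + g x)%R) <=
   (1 + e)%:E * energy f + (1 + e^-1)%:E * energy g)%E.
Proof.
move=> e0 mf mg; have mfg := cmeasurableD mf mg.
have a0 : 0 <= 1 + e by rewrite addr_ge0// ltW.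
have b0 : 0 <= 1 + e^-1 by rewrite addr_ge0// invr_ge0 ltW.
have md := measurable_energy_density.
have d0 := energy_density_ge0.
rewrite /energy -(ge0_integralZl_EFin _ measurableT _ (md _ mf) a0);
  last by move=> x _; exact: d0.
rewrite -(ge0_integralZl_EFin _ measurableT _ (md _ mg) b0);
  last by move=> x _; exact: d0.
rewrite -ge0_integralD//; last 4 first.
- by move=> x _; rewrite mule_ge0// d0.
- by apply: measurable_funeM; exact: md.
- by move=> x _; rewrite mule_ge0// d0.
- by apply: measurable_funeM; exact: md.
apply: ge0_le_integral.
- by [].
- by move=> x _; rewrite lee_fin mulr_ge0// sqr_ge0.
- exact: (md _ mfg).
- by apply: emeasurable_funD; apply: measurable_funeM; exact: md.
- move=> x _; rewrite -!EFinM -EFinD lee_fin.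
  apply: le_trans (ler_wpM2l (w0 x) (cabs_sqrD (f x) (g x) e0)) _.
  by rewrite le_eqVlt; apply/orP; left; apply/eqP; ring.
Qed.

Lemma energyD f g : cmeasurable f -> cmeasurable g ->
  (energy (fun x => (f x + g x)%R) <= 2%:E * energy f + 2%:E * energy g)%E.
Proof. by move=> mf mg; have := energyD_scaled ltr01 mf mg; rewrite invr1. Qed.

Lemma energyZ (a : C) f : cmeasurable f ->
  energy (fun x => a * f x) = ((cabs a ^+ 2)%:E * energy f)%E.
Proof.
move=> mf; rewrite /energy -ge0_integralZl_EFin//; last 3 first.
- by move=> x _; exact: energy_density_ge0.
- exact: measurable_energy_density.
- exact: sqr_ge0.
by apply: eq_integral => x _; rewrite -EFinM cabs_sqrM mulrCA.
Qed.

Lemma finite_energy_lin (a : C) f g : finite_energy f -> finite_energy g ->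
  finite_energy (fun x => a * f x + g x).
Proof.
move=> [mf ef] [mg eg]; have maf := cmeasurableZ a mf.
split; first exact: cmeasurableD.
apply: le_lt_trans (energyD maf mg) _; rewrite energyZ//.
apply: lte_add_pinfty; apply: lte_mul_pinfty => //.
by apply: lte_mul_pinfty => //; rewrite lee_fin sqr_ge0.
Qed.

Definition rform (f g : T -> R) : R := Rintegral mu setT (fun x => w x * (f x * g x)).

Let good (f : T -> R) :=
  measurable_fun setT f /\ (\int[mu]_x (w x * f x ^+ 2)%:E < +oo)%E.

Let good_int (f g : T -> R) : good f -> good g ->
  mu.-integrable setT (fun x => (w x * (f x * g x))%:E).
Proof.
move=> [mf ef] [mg eg]; apply/integrableP; split.
  by apply/measurable_EFinP; do 2 apply: measurable_funM => //.
have mq (u : T -> R) : measurable_fun setT u ->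
    measurable_fun setT (fun x => (w x * u x ^+ 2)%:E).
  move=> mu'; apply/measurable_EFinP; apply: measurable_funM => //.
  exact: measurable_funX.
have q0 (u : T -> R) x : (0 <= (w x * u x ^+ 2)%:E)%E by rewrite lee_fin mulr_ge0// sqr_ge0.
apply: (@le_lt_trans _ _ (\int[mu]_x ((w x * f x ^+ 2)%:E + (w x * g x ^+ 2)%:E))%E).
  apply: ge0_le_integral.
  - by [].
  - by move=> x _; exact: abse_ge0.
  - apply: measurableT_comp => //; apply/measurable_EFinP.
    by do 2 apply: measurable_funM => //.
  - by apply: emeasurable_funD; exact: mq.
  - move=> x _; rewrite abse_EFin lee_fin normrM ger0_norm// -mulrDr ler_wpM2l//.
    by rewrite ler_norml; nra.
rewrite ge0_integralD//; try exact: mq.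
by rewrite lte_add_pinfty.
Qed.

Let rformC (f g : T -> R) : rform f g = rform g f.
Proof. by rewrite /rform; apply: eq_Rintegral => x _; rewrite [f x * _]mulrC. Qed.

Let rform_lin (f : T -> R) (a b : R) (g1 g2 g3 : T -> R) :
  good f -> good g1 -> good g2 -> good g3 ->
  rform f (fun x => a * g1 x + b * g2 x + g3 x) =
  a * rform f g1 + b * rform f g2 + rform f g3.
Proof.
move=> gf gg1 gg2 gg3; rewrite /rform.
have i1 := good_int gf gg1; have i2 := good_int gf gg2; have i3 := good_int gf gg3.
have ia (c : R) (g : T -> R) : mu.-integrable setT (fun x => (w x * (f x * g x))%:E) ->
    mu.-integrable setT (EFin \o (fun x => c * (w x * (f x * g x)))).
  move=> ig; under [X in mu.-integrable _ X]eq_fun do rewrite /= EFinM.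
  exact: integrableZl.
transitivity (\int[mu]_x (a * (w x * (f x * g1 x)) + b * (w x * (f x * g2 x)) +
  w x * (f x * g3 x))).
  by apply: eq_Rintegral => x _; ring.
rewrite RintegralD//; last first.
  under [X in mu.-integrable _ X]eq_fun do rewrite /= EFinD.
  by apply: integrableD => //; exact: ia.
rewrite RintegralD//; try exact: ia.
by rewrite !RintegralZl.
Qed.

Definition cform f g : C :=
  ((rform (@complex.Re R \o f) (@complex.Re R \o g) +
    rform (@complex.Im R \o f) (@complex.Im R \o g)) +i*
   (rform (@complex.Re R \o f) (@complex.Im R \o g) -
    rform (@complex.Im R \o f) (@complex.Re R \o g)))%C.

Let goodRI f : finite_energy f -> good (@complex.Re R \o f) /\ good (@complex.Im R \o f).
Proof.
move=> [[mr mi] ef]; split; split => //; apply: le_lt_trans ef; apply: ge0_le_integral.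
- by [].
- by move=> x _; rewrite lee_fin mulr_ge0// sqr_ge0.
- by apply/measurable_EFinP; apply: measurable_funM => //; exact: measurable_funX.
- by apply: measurable_energy_density; split.
- by move=> x _; rewrite lee_fin ler_wpM2l// cabs_sqr lerDl sqr_ge0.
- by [].
- by move=> x _; rewrite lee_fin mulr_ge0// sqr_ge0.
- by apply/measurable_EFinP; apply: measurable_funM => //; exact: measurable_funX.
- by apply: measurable_energy_density; split.
- by move=> x _; rewrite lee_fin ler_wpM2l// cabs_sqr lerDr sqr_ge0.
Qed.

Lemma cform_linear f (a : C) g h :
  finite_energy f -> finite_energy g -> finite_energy h ->
  cform f (fun x => a * g x + h x) = a * cform f g + cform f h.
Proof.
move=> /goodRI[fr fi] /goodRI[gr gi] /goodRI[hr hi]; rewrite /cform.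
have -> : @complex.Re R \o (fun x => a * g x + h x) = fun x =>
    complex.Re a * (@complex.Re R \o g) x +
    (- complex.Im a) * (@complex.Im R \o g) x + (@complex.Re R \o h) x.
  by apply/funext => x; rewrite /= addcE mulcE/=; ring.
have -> : @complex.Im R \o (fun x => a * g x + h x) = fun x =>
    complex.Re a * (@complex.Im R \o g) x +
    complex.Im a * (@complex.Re R \o g) x + (@complex.Im R \o h) x.
  by apply/funext => x; rewrite /= addcE mulcE/=; ring.
rewrite !rform_lin// mulcE addcE/=.
by congr (_ +i* _)%C; ring.
Qed.

Lemma cform_conj f g : cform g f = (cform f g)^*.
Proof.
rewrite conjcE /cform/=.
rewrite [rform (@complex.Re R \o g) (@complex.Re R \o f)]rformC.
rewrite [rform (@complex.Im R \o g) (@complex.Im R \o f)]rformC.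
rewrite [rform (@complex.Re R \o g) (@complex.Im R \o f)]rformC.
rewrite [rform (@complex.Im R \o g) (@complex.Re R \o f)]rformC.
by congr (_ +i* _)%C; ring.
Qed.

Lemma energyE f : finite_energy f -> energy f = (complex.Re (cform f f))%:E.
Proof.
move=> ef; have [gr gi] := goodRI ef; rewrite /=.
have ir := good_int gr gr; have ii := good_int gi gi.
rewrite /rform -RintegralD// /Rintegral fineK.
  by apply: eq_integral => x _; rewrite cabs_sqr /=; congr (_%:E); ring.
apply: integrable_fin_num => //.
by under eq_fun do rewrite EFinD; exact: integrableD.
Qed.

End weighted_energy.

(** * Lower semicontinuity of energies *)

Section lower_limits.
Context {R : realType}.

Lemma einfs_le (u : (\bar R)^nat) n : (einfs u n <= u n)%E.
Proof. by apply: ereal_inf_lbound; exists n => /=. Qed.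

Lemma limn_einfD_le (u v : (\bar R)^nat) (B : R^nat) (b : R) :
  (forall n, 0 <= u n)%E -> (forall n, 0 <= v n)%E ->
  (forall n, u n + v n <= (B n)%:E)%E -> B @ \oo --> b ->
  (limn_einf u + limn_einf v <= b%:E)%E.
Proof.
move=> u0 v0 uvB Bb.
have e0 (w : (\bar R)^nat) n : (forall n, 0 <= w n)%E -> (0 <= einfs w n)%E.
  by move=> w0; apply: le_ereal_inf_tmp => _ [m _ <-].
have l0 (w : (\bar R)^nat) : (forall n, 0 <= w n)%E -> (0 <= limn (einfs w))%E.
  by move=> w0; apply: lime_ge; [exact: is_cvg_einfs|apply: nearW => n; exact: e0].
have def : (limn (einfs u) +? limn (einfs v))%E by apply: ge0_adde_def; rewrite inE l0.
rewrite !limn_einf_lim -limeD//; [|exact: is_cvg_einfs|exact: is_cvg_einfs].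
have cB : (EFin \o B) @ \oo --> b%:E by apply: cvg_EFin => //; exact: nearW.
rewrite -(cvg_lim _ cB)//; apply: lee_lim; last 2 first.
- by apply: cvgP cB.
- apply: nearW => n /=; apply: le_trans (uvB n); apply: leeD; exact: einfs_le.
by apply: is_cvgeD => //; exact: is_cvg_einfs.
Qed.

End lower_limits.

Section energy_limits.
Context dT (T : measurableType dT) {R : realType}.
Local Notation C := R[i].
Implicit Types (f g h : T -> C).
Variables (mu : {measure set T -> \bar R}).

Definition ccvg (z_ : C^nat) (z : C) : Prop :=
  (fun n => complex.Re (z_ n)) @ \oo --> complex.Re z /\
  (fun n => complex.Im (z_ n)) @ \oo --> complex.Im z.

Lemma ccvgB (y_ z_ : C^nat) (y z : C) : ccvg y_ y -> ccvg z_ z ->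
  ccvg (fun n => y_ n - z_ n) (y - z).
Proof.
move=> [yr yi] [zr zi]; split.
  under eq_fun do rewrite addcE oppcE/=.
  by rewrite addcE oppcE/=; exact: cvgB.
under eq_fun do rewrite addcE oppcE/=.
by rewrite addcE oppcE/=; exact: cvgB.
Qed.

Lemma ccvg_cabs_sqr (z_ : C^nat) (z : C) : ccvg z_ z ->
  (fun n => cabs (z_ n) ^+ 2) @ \oo --> cabs z ^+ 2.
Proof.
move=> [zr zi]; under eq_fun do rewrite cabs_sqr.
rewrite cabs_sqr; apply: cvgD; exact: cvgM.
Qed.

Lemma energy_fatou (w : T -> R) (f_ : nat -> T -> C) f :
  (forall x, 0 <= w x) -> measurable_fun setT w ->
  (forall n, cmeasurable (f_ n)) -> cmeasurable f ->
  {ae mu, forall x, ccvg (f_ ^~ x) (f x)} ->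
  (energy mu w f <= limn_einf (fun n => energy mu w (f_ n)))%E.
Proof.
move=> w0 mw mf_ mf [N [mN N0 subN]].
have eN g : cmeasurable g ->
    energy mu w g = (\int[mu]_(x in ~` N) (w x * cabs (g x) ^+ 2)%:E)%E.
  move=> mg; rewrite /energy (ge0_negligible_integral mN)// ?setTD//.
  - exact: measurable_energy_density.
  - by move=> x _; exact: energy_density_ge0.
rewrite eN//; under [X in (_ <= limn_einf X)%E]eq_fun do rewrite eN//.
apply: (@le_trans _ _ (\int[mu]_(x in ~` N)
    limn_einf (fun n => (w x * cabs (f_ n x) ^+ 2)%:E))%E).
  rewrite le_eqVlt; apply/orP; left; apply/eqP.
  apply: eq_integral => x /[!inE] /= xN.
  have /ccvg_cabs_sqr cf : ccvg (f_ ^~ x) (f x) by apply: contrapT => h; exact/xN/subN.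
  apply/esym; apply: (@cvg_limn_einf_sup _ _ (w x * cabs (f x) ^+ 2)%:E _).1.
  by apply: cvg_EFin; [exact: nearW|apply: cvgM => //; exact: cvg_cst].
apply: fatou; first exact: measurableC.
- by move=> n; apply: measurable_funTS; exact: measurable_energy_density.
- by move=> n x _; exact: energy_density_ge0.
Qed.

Lemma ae_cvg_fast (f_ : nat -> T -> C) f :
  (forall n, cmeasurable (f_ n)) -> cmeasurable f ->
  (forall n, energy mu (fun=> 1%R) (fun x => (f_ n x - f x)%R) <=
     (1 / (2 ^ n.+1)%:R)%:E)%E ->
  {ae mu, forall x, ccvg (f_ ^~ x) (f x)}.
Proof.
move=> mf_ mf ef.
pose g n x := (cabs (f_ n x - f x) ^+ 2)%:E : \bar R.
have md n : cmeasurable (fun x => f_ n x - f x).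
  by apply: cmeasurableD => //; exact: cmeasurableN.
have g0 n x : (0 <= g n x)%E by rewrite lee_fin sqr_ge0.
have mg n : measurable_fun setT (g n).
  by apply/measurable_EFinP; exact: measurable_cabs_sqr.
pose S x := (\sum_(n <oo) g n x)%E.
have iS : mu.-integrable setT S.
  apply/integrableP; split; first exact: ge0_emeasurable_sum.
  under eq_integral do rewrite gee0_abs ?nneseries_ge0//.
  rewrite integral_nneseries//.
  apply: le_lt_trans (_ : _ < +oo)%E; last exact: ltry 1.
  apply: le_trans (epsilon_trick0 xpredT (@ler01 R)).
  apply: lee_nneseries => [n _ _|n _]; first exact: integral_ge0.
  by apply: le_trans (ef n); rewrite /energy/g; under [leRHS]eq_integral do rewrite mul1r.
apply: filterS (integrable_ae measurableT iS) => x /(_ I) Sfin.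
have gc : (cabs (f_ n x - f x) ^+ 2) @[n --> \oo] --> (0 : R).
  have Sx : (S x < +oo)%E by rewrite ltey_eq Sfin.
  have tl := nneseries_tail_cvg Sx (fun k _ => g0 k x).
  apply: (@fine_cvg _ _ _ _ (g ^~ x) 0).
  apply: squeeze_cvge tl; [|exact: cvg_cst].
  apply: nearW => n; rewrite g0/=.
  apply: le_trans (nneseries_lim_ge n.+1 (fun k _ _ => g0 k x)).
  by rewrite big_nat1.
have sq0 (a_ : R^nat) a :
    (forall n, (a_ n - a) ^+ 2 <= cabs (f_ n x - f x) ^+ 2) -> a_ @ \oo --> a.
  move=> ale; apply/cvgrPdist_lt => e e0.
  move/cvgrPdist_lt : gc => /(_ _ (exprn_gt0 2 e0)).
  apply: filterS => n; rewrite sub0r normrN ger0_norm ?sqr_ge0// => /(le_lt_trans (ale n)).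
  by rewrite distrC -[X in X < _ -> _]real_normK ?num_real// ltr_pXn2r ?nnegrE// (ltW e0).
split; apply: sq0 => n; rewrite cabs_sqr addcE oppcE/=.
  by rewrite lerDl sqr_ge0.
by rewrite lerDr sqr_ge0.
Qed.

End energy_limits.

(** * Kinetic energy and the Gagliardo seminorm *)

Section euclidean_energies.
Context {R : realType} (d : nat).
Local Notation E := (d.-tuple R).
Local Notation C := R[i].
Implicit Types (u v : E -> C).

Lemma L2norm_ge0 u : (0 <= L2norm u)%E.
Proof. exact: Lnorm_ge0. Qed.

Lemma L2norm_sqr u : (L2norm u ^+ 2 = energy (leb R d) (fun=> 1%R) u)%E.
Proof.
have -> : (L2norm u ^+ 2 = L2norm u `^ 2)%E.
  have := L2norm_ge0 u; case: (L2norm u) => [r r0| _|//].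
    by rewrite poweR_EFin -EFin_expe powR_mulrn.
  by rewrite poweRyr ?pnatr_eq0// expe2 mulyy.
rewrite poweR_Lnorm ?pnatr_eq0//; apply: eq_integral => x _ /=.
by rewrite mul1r ger0_norm ?cabs_ge0// powR_mulrn// cabs_ge0.
Qed.

Lemma L2norm_lt u (e : R) : 0 < e ->
  (energy (leb R d) (fun=> 1%R) u < (e ^+ 2)%:E)%E -> (L2norm u < e%:E)%E.
Proof.
move=> e0; rewrite -L2norm_sqr; have := L2norm_ge0 u.
case: (L2norm u) => [r r0|_|//].
  by rewrite -EFin_expe !lte_fin ltr_pXn2r ?nnegrE// ltW.
by rewrite expe2 mulyy.
Qed.

Lemma energy_lt_L2norm u (e : R) : 0 < e ->
  (L2norm u < e%:E)%E -> (energy (leb R d) (fun=> 1%R) u <= (e ^+ 2)%:E)%E.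
Proof.
move=> e0; rewrite -L2norm_sqr; have := L2norm_ge0 u.
case: (L2norm u) => [r r0|//|//].
by rewrite -EFin_expe !lte_fin lee_fin => re; rewrite lerXn2r ?nnegrE// ltW.
Qed.

Lemma L2E u : L2 u <-> finite_energy (leb R d) (fun=> 1%R) u.
Proof.
have e : (L2norm u < +oo)%E <-> (energy (leb R d) (fun=> 1%R) u < +oo)%E.
  rewrite -L2norm_sqr; have := L2norm_ge0 u.
  by case: (L2norm u) => [r r0|_|//]; rewrite ?expe2 ?mulyy// -EFinM !ltry.
split; first by move=> [mr mi /e].
by move=> [[mr mi] /e].
Qed.

Definition increment u (p : E * E) : C := u (tadd p.2 p.1) - u p.2.

Lemma measurable_shift : measurable_fun setT (fun p : E * E => tadd p.2 p.1).
Proof. exact: measurable_tadd. Qed.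

Lemma cmeasurable_comp dT (T : measurableType dT) (phi : T -> E) u :
  measurable_fun setT phi -> cmeasurable u -> cmeasurable (u \o phi).
Proof.
move=> mphi [mr mi]; split; first exact: (measurableT_comp mr mphi).
exact: (measurableT_comp mi mphi).
Qed.

Lemma cmeasurable_increment u : cmeasurable u -> cmeasurable (increment u).
Proof.
move=> mu; apply: cmeasurableD.
  exact: (cmeasurable_comp measurable_shift mu).
by apply: cmeasurableN; exact: (cmeasurable_comp measurable_snd mu).
Qed.

Lemma increment_lin (a : C) u v :
  increment (fun x => a * u x + v x) = fun p => a * increment u p + increment v p.
Proof. by apply/funext => p; rewrite /increment; ring. Qed.

Local Notation leb2 := (sleb d \x sleb d)%E.

Lemma energy_iterated (w : E -> R) (f : E * E -> C) :
  (forall x, 0 <= w x) -> measurable_fun setT w -> cmeasurable f ->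
  energy leb2 (w \o fst) f =
  (\int[leb R d]_h \int[leb R d]_x (w h * cabs (f (h, x)) ^+ 2)%:E)%E.
Proof.
move=> w0 mw mf; rewrite /energy fubini_tonelli1//.
- by apply: measurable_energy_density => //; exact: (measurableT_comp mw measurable_fst).
- by move=> x; rewrite lee_fin; exact: (mulr_ge0 (w0 _) (sqr_ge0 _)).
Qed.

Lemma enorm_eq0 (h x : E) : enorm h = 0 -> tadd x h = x.
Proof.
move=> h0; apply: eq_from_tnth => i; rewrite tnth_mktuple.
have := ler_tnth_enorm h i; rewrite h0 normr_le0 => /eqP ->.
by rewrite addr0.
Qed.

Lemma energy_le_weight dT (T : measurableType dT) (mu : {measure set T -> \bar R})
    (w w' : T -> R) (f : T -> C) (K : R) :
  (forall x, 0 <= w x) -> measurable_fun setT w ->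
  (forall x, 0 <= w' x) -> measurable_fun setT w' ->
  cmeasurable f -> 0 <= K ->
  {ae mu, forall x, w x * cabs (f x) ^+ 2 <= K * (w' x * cabs (f x) ^+ 2)} ->
  (energy mu w f <= K%:E * energy mu w' f)%E.
Proof.
move=> w0 mw w'0 mw' mf K0 ww'; rewrite /energy -ge0_integralZl_EFin//.
- apply: ae_ge0_le_integral => //.
  + by move=> x _; exact: energy_density_ge0.
  + exact: measurable_energy_density.
  + by move=> x _; rewrite mule_ge0// energy_density_ge0.
  + by apply: measurable_funeM; exact: measurable_energy_density.
  + by apply: filterS ww' => x h _; rewrite -EFinM lee_fin.
- by move=> x _; exact: energy_density_ge0.
- exact: measurable_energy_density.
Qed.

Lemma energy_add_weight dT (T : measurableType dT) (mu : {measure set T -> \bar R})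
    (w w' : T -> R) (f : T -> C) :
  (forall x, 0 <= w x) -> measurable_fun setT w ->
  (forall x, 0 <= w' x) -> measurable_fun setT w' ->
  cmeasurable f ->
  energy mu (fun x => w x + w' x) f = (energy mu w f + energy mu w' f)%E.
Proof.
move=> w0 mw w'0 mw' mf; rewrite /energy -ge0_integralD//.
- by apply: eq_integral => x _; rewrite mulrDl.
- by move=> x _; exact: energy_density_ge0.
- exact: measurable_energy_density.
- by move=> x _; exact: energy_density_ge0.
- exact: measurable_energy_density.
Qed.

Lemma energy_shift (w : E -> R) u : (forall x, 0 <= w x) ->
  measurable_fun setT w -> cmeasurable u ->
  energy leb2 (w \o fst) (fun p => u (tadd p.2 p.1)) =
  (\int[leb R d]_h (w h)%:E * energy (leb R d) (fun=> 1%R) u)%E.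
Proof.
move=> w0 mw mu; rewrite energy_iterated//;
  last exact: (cmeasurable_comp measurable_shift mu).
rewrite -ge0_integralZr//; last 3 first.
- exact/measurable_EFinP.
- by move=> x _; rewrite lee_fin.
- exact: energy_ge0.
apply: eq_integral => h _.
rewrite (@ge0_integral_translate R d h (fun x => (w h * cabs (u x) ^+ 2)%:E)); last 2 first.
- by apply/measurable_EFinP; apply: measurable_funM => //; exact: measurable_cabs_sqr.
- by move=> x; rewrite lee_fin mulr_ge0// sqr_ge0.
rewrite /energy -ge0_integralZl_EFin//.
- by apply: eq_integral => x _; rewrite mul1r EFinM.
- by move=> x _; rewrite lee_fin mul1r sqr_ge0.
- by apply: measurable_energy_density.
Qed.

Lemma energy_fst (w : E -> R) u : (forall x, 0 <= w x) ->
  measurable_fun setT w -> cmeasurable u ->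
  energy leb2 (w \o fst) (fun p => u p.2) =
  (\int[leb R d]_h (w h)%:E * energy (leb R d) (fun=> 1%R) u)%E.
Proof.
move=> w0 mw mu; rewrite energy_iterated//;
  last exact: (cmeasurable_comp measurable_snd mu).
rewrite -ge0_integralZr//; last 3 first.
- exact/measurable_EFinP.
- by move=> x _; rewrite lee_fin.
- exact: energy_ge0.
apply: eq_integral => h _.
rewrite /energy -ge0_integralZl_EFin//.
- by apply: eq_integral => x _; rewrite mul1r EFinM.
- by move=> x _; rewrite lee_fin mul1r sqr_ge0.
- by apply: measurable_energy_density.
Qed.

Lemma energy_increment_lty (w : E -> R) u : (forall x, 0 <= w x) ->
  measurable_fun setT w -> (\int[leb R d]_h (w h)%:E < +oo)%E ->
  finite_energy (leb R d) (fun=> 1%R) u ->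
  (energy leb2 (w \o fst) (increment u) < +oo)%E.
Proof.
move=> w0 mw iw [mu eu].
have mw' : measurable_fun setT (w \o @fst E E) by exact: measurableT_comp.
have w0' x : 0 <= (w \o @fst E E) x by exact: w0.
have ms := cmeasurable_comp measurable_shift mu.
have m2 : cmeasurable (fun p : E * E => - u p.2).
  by apply: cmeasurableN; exact: (cmeasurable_comp measurable_snd mu).
apply: le_lt_trans (energyD leb2 w0' mw' ms m2) _.
have fin : (\int[leb R d]_h (w h)%:E * energy (leb R d) (fun=> 1%R) u < +oo)%E.
  by apply: lte_mul_pinfty => //; [apply: integral_ge0 => x _; rewrite lee_fin|
    rewrite ge0_fin_numE//; apply: integral_ge0 => x _; rewrite lee_fin].
have -> : energy leb2 (w \o fst) (fun p => - u p.2) =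
    energy leb2 (w \o fst) (fun p => u p.2).
  by apply: eq_integral => p _; rewrite cabsN.
rewrite [X in (_ * X + _)%E](energy_shift w0 mw mu) energy_fst//.
by apply: lte_add_pinfty; apply: lte_mul_pinfty.
Qed.

End euclidean_energies.

Section kinetic_energy.
Context {R : realType} (d : nat) (m alpha : R).
Hypotheses (d0 : (0 < d)%N) (m0 : 0 <= m) (al0 : 0 < alpha) (al2 : alpha < 2).
Local Notation E := (d.-tuple R).
Local Notation C := R[i].
Local Notation leb2 := (sleb d \x sleb d)%E.
Implicit Types (u v : E -> C).

(* At [h = 0] this is [0 `^ (- (d + alpha)) = 0]. *)
Definition riesz_weight (h : E) : R := enorm h `^ (- (d%:R + alpha)).

Definition levy_weight (h : E) : R := riesz_weight h * Num.min 1 (enorm h ^+ 2).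

Definition jweight (h : E) : R := 2^-1 * jkernel d m alpha (enorm h).

Lemma riesz_weight_ge0 h : 0 <= riesz_weight h.
Proof. exact: powR_ge0. Qed.

Lemma measurable_riesz_weight : measurable_fun setT riesz_weight.
Proof. exact: (measurableT_comp (measurable_powR _) (@measurable_enorm R d)). Qed.

Lemma levy_weight_ge0 h : 0 <= levy_weight h.
Proof. by rewrite mulr_ge0 ?riesz_weight_ge0// le_min ler01 sqr_ge0. Qed.

Lemma measurable_levy_weight : measurable_fun setT levy_weight.
Proof.
apply: measurable_funM; first exact: measurable_riesz_weight.
apply: measurable_minr; first exact: measurable_cst.
by apply: measurable_funX; exact: measurable_enorm.
Qed.

Lemma jweight_ge0 h : 0 <= jweight h.
Proof. by rewrite mulr_ge0 ?invr_ge0// jkernel_ge0. Qed.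

Lemma measurable_jweight : measurable_fun setT jweight.
Proof.
apply: measurable_funM => //.
exact: (measurableT_comp (measurable_jkernel _ _ _) (@measurable_enorm R d)).
Qed.

Lemma leb_growth (r : R) : 0 < r ->
  (leb R d [set x | (enorm x <= r)%R] <= (2 ^+ d * r `^ d%:R)%:E)%E.
Proof.
move=> r0; apply: le_trans (leb_ball d (ltW r0)) _.
by rewrite powR_mulrn ?(ltW r0)// exprMn.
Qed.

Lemma levy_weight_lty : (\int[leb R d]_h (levy_weight h)%:E < +oo)%E.
Proof.
pose D1 := [set h : E | 0 < enorm h <= 1].
pose D2 := [set h : E | 1 < enorm h].
have me := @measurable_enorm R d.
have mD2 : measurable D2.
  by rewrite -[D2]setTI; exact: (measurable_fun_ltr (measurable_cst _) me).
have mD1 : measurable D1.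
  rewrite (_ : D1 = [set h : E | 0 < enorm h] `&` ~` D2); last first.
    apply/seteqP; split => h; rewrite /D1 /D2/=.
      by move=> /andP[-> h1]; split => //; apply/negP; rewrite -leNgt.
    by move=> [-> /negP]; rewrite -leNgt.
  apply: measurableI; last exact: measurableC.
  by rewrite -[X in measurable X]setTI; exact: (measurable_fun_ltr (measurable_cst _) me).
have ml D : measurable_fun D levy_weight.
  by apply: measurable_funTS; exact: measurable_levy_weight.
have mp a D : measurable_fun D (fun h : E => enorm h `^ a).
  by apply: measurable_funTS; exact: (measurableT_comp (measurable_powR _) me).
have -> : (\int[leb R d]_h (levy_weight h)%:E =
    \int[leb R d]_(h in D1 `|` D2) (levy_weight h)%:E)%E.
  rewrite [RHS]integral_mkcond; apply: eq_integral => h _; rewrite patchE.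
  case: ifPn => // /negP hD; suff -> : levy_weight h = 0 by [].
  have h0 : enorm h = 0.
    apply/eqP; rewrite eq_le enorm_ge0 andbT leNgt; apply/negP => h0; apply: hD.
    apply/mem_set; case: (leP (enorm h) 1) => h1; last by right.
    by left; rewrite /D1/= h0.
  by rewrite /levy_weight h0 expr2 mulr0 minEle ler10 mulr0.
rewrite ge0_integral_setU//; last 3 first.
- by apply/measurable_EFinP.
- by move=> h _; rewrite lee_fin levy_weight_ge0.
- apply/disj_setPS => h /= []; rewrite /D1 /D2/= => /andP[_ h1].
  by rewrite ltNge h1.
(* Near the origin [min(1, |h|^2) <= |h|^g]; with [g] at most [d + alpha] the
   resulting power of [|h|] is nonpositive also when [d + alpha < 2]. *)
pose g := Num.min 2 (d%:R + alpha).
have dr : 1 <= d%:R :> R by rewrite ler1n.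
have g2 : g <= 2 by rewrite ge_min lexx.
have gd : g <= d%:R + alpha by rewrite ge_min lexx orbT.
have ga : alpha < g by rewrite lt_min al2 ltrDr ltr0n d0.
have p2d : 0 <= 2 ^+ d :> R by rewrite exprn_ge0.
have sD : 0 <= d%:R + alpha - g < d%:R by apply/andP; split; lra.
apply: lte_add_pinfty.
  have := @integral_powRN_near0 R _ _ (leb R d) D1 mD1 _ me (2 ^+ d) d%:R p2d leb_growth
    (d%:R + alpha - g) 1 sD ltr01 (fun x h => h).
  move=> /(le_integral_scale mD1 (ml D1) (mp _ _) (@ler01 R)).
  move=> /(_ _ _)/le_lt_trans; apply; last exact: ltry.
  - by move=> h _; exact: powR_ge0.
  - move=> h /andP[h0 h1]; rewrite levy_weight_ge0 mul1r /levy_weight/riesz_weight/=.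
    rewrite opprB addrC powRDgt0// [leRHS]mulrC ler_wpM2l ?powR_ge0//.
    rewrite ge_min; apply/orP; right; rewrite -powR_mulrn ?enorm_ge0//.
    by rewrite !powRE_gt0// ler_expR ler_wnM2r// ln_le0.
have s0 : 0 <= d%:R + alpha by rewrite addr_ge0// (ltW al0).
have sd : d%:R < d%:R + alpha by rewrite ltrDl.
have := @integral_powRN_infty R _ _ (leb R d) D2 mD2 _ me (2 ^+ d) d%:R p2d leb_growth
    (d%:R + alpha) 1 s0 sd ltr01 (fun x h => ltW h).
move=> /(le_integral_scale mD2 (ml D2) (mp _ _) (@ler01 R)).
move=> /(_ _ _)/le_lt_trans; apply; last exact: ltry.
- by move=> h _; exact: powR_ge0.
- move=> h h1; rewrite levy_weight_ge0 mul1r /levy_weight.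
  by rewrite -[leRHS]mulr1 ler_wpM2l ?powR_ge0// ge_min lexx.
Qed.

Lemma kineticE u : cmeasurable u ->
  kinetic m alpha u = energy leb2 (jweight \o fst) (increment u).
Proof.
move=> mu; rewrite energy_iterated//; last 3 first.
- exact: jweight_ge0.
- exact: measurable_jweight.
- exact: cmeasurable_increment.
have mi := cmeasurable_increment mu.
pose F (p : E * E) := (cabs (increment u p) ^+ 2 * jkernel d m alpha (enorm p.1))%:E.
have mF : measurable_fun setT F.
  apply/measurable_EFinP; apply: measurable_funM; first exact: measurable_cabs_sqr.
  apply: (measurableT_comp (measurable_jkernel _ _ _)).
  exact: (measurableT_comp (@measurable_enorm R d) measurable_fst).
have F0 p : (0 <= F p)%E by rewrite lee_fin mulr_ge0 ?sqr_ge0// jkernel_ge0.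
rewrite /kinetic -ge0_integralZl_EFin//; last 2 first.
- by move=> h _; apply: integral_ge0 => x _; exact: (F0 (h, x)).
- exact: (measurable_fun_fubini_tonelli_F (m2 := sleb d) F mF F0).
apply: eq_integral => h _; rewrite -ge0_integralZl_EFin//; last 2 first.
- by move=> x _; exact: (F0 (h, x)).
- exact: (measurableT_comp mF (measurable_pair1 h)).
apply: eq_integral => x _; rewrite -EFinM /jweight /increment/=.
by congr (_%:E); ring.
Qed.

Lemma gagliardoE u : cmeasurable u ->
  (\int[leb R d]_x \int[leb R d]_y
     (cabs (u x - u y) ^+ 2 / enorm (tsub x y) `^ (d%:R + 2 * (alpha / 2)))%:E)%E =
  energy leb2 (riesz_weight \o fst) (increment u).
Proof.
move=> mu; have mi := cmeasurable_increment mu.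
pose F (p : E * E) := ((riesz_weight \o fst) p * cabs (increment u p) ^+ 2)%:E.
have mF : measurable_fun setT F.
  apply: measurable_energy_density => //.
  exact: (measurableT_comp measurable_riesz_weight measurable_fst).
have F0 p : (0 <= F p)%E.
  by rewrite lee_fin; exact: (mulr_ge0 (riesz_weight_ge0 _) (sqr_ge0 _)).
rewrite [RHS](fubini_tonelli2 F mF F0); apply: eq_integral => x _.
pose G y := (cabs (u x - u y) ^+ 2 / enorm (tsub x y) `^ (d%:R + 2 * (alpha / 2)))%:E.
have mts : measurable_fun setT (tsub x).
  apply/measurable_fun_tnthP => i.
  rewrite (_ : _ \o _ = fun y => tnth x i - tnth y i); last first.
    by apply/funext => y; rewrite /= tnth_mktuple.
  by apply: measurable_funB => //; exact: measurable_tnth.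
have mG : measurable_fun setT G.
  apply/measurable_EFinP; apply: measurable_funM.
    apply: measurable_cabs_sqr; apply: cmeasurableD; first by split.
    exact: cmeasurableN.
  apply: (measurableT_comp (@measurable_inv R)).
  apply: (measurableT_comp (measurable_powR _)).
  exact: (measurableT_comp (@measurable_enorm R d) mts).
have G0 y : (0 <= G y)%E by rewrite lee_fin mulr_ge0 ?sqr_ge0// invr_ge0 powR_ge0.
rewrite -/G -(ge0_integral_translate x mG G0); apply: eq_integral => h _.
rewrite /G /F /riesz_weight /increment/=; congr (_%:E).
have -> : tadd h x = tadd x h by apply: eq_from_tnth => i; rewrite !tnth_mktuple addrC.
have -> : enorm (tsub x (tadd x h)) = enorm h.
  congr (Num.sqrt _); apply: eq_bigr => i _; rewrite !tnth_mktuple.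
  by rewrite opprD addNKr sqrrN.
rewrite -cabsN opprB mulrC powRN; congr (_^-1 * _); congr (_ `^ _); lra.
Qed.

Lemma riesz_energy_lty u : finite_energy (leb R d) (fun=> 1%R) u ->
  (energy leb2 (riesz_weight \o fst) (increment u) < +oo)%E <->
  (energy leb2 (jweight \o fst) (increment u) < +oo)%E.
Proof.
move=> fu; have [mu eu] := fu; have mi := cmeasurable_increment mu.
have [c [K [c0 K0 up low]]] := jkernel_bounds d m0 al0 al2.
have comp (w : E -> R) : measurable_fun setT w -> measurable_fun setT (w \o @fst E E).
  by move=> mw; exact: (measurableT_comp mw measurable_fst).
have mr := comp _ measurable_riesz_weight.
have mj := comp _ measurable_jweight.
have ml := comp _ measurable_levy_weight.
have r0 (p : E * E) : 0 <= (riesz_weight \o fst) p by exact: riesz_weight_ge0.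
have j0 (p : E * E) : 0 <= (jweight \o fst) p by exact: jweight_ge0.
have l0 (p : E * E) : 0 <= (levy_weight \o fst) p by exact: levy_weight_ge0.
have inc0 (h x : E) : ~~ (0 < enorm h) -> increment u (h, x) = 0.
  rewrite -leNgt => h0; rewrite /increment/= enorm_eq0 ?subrr//.
  by apply/eqP; rewrite eq_le h0 enorm_ge0.
split => [er|ej].
  have K2 : 0 <= K / 2 by rewrite divr_ge0// ltW.
  apply: le_lt_trans (energy_le_weight (mu := leb2) j0 mj r0 mr mi K2 _) _; last first.
    by apply: lte_mul_pinfty => //.
  apply: aeW => -[h x]; have [h0|h0] := boolP (0 < enorm h); last first.
    by rewrite inc0// cabs0 expr2 !mulr0.
  rewrite mulrA; apply: ler_wpM2r; first exact: sqr_ge0.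
  by rewrite /jweight/riesz_weight/= [K / 2]mulrC -mulrA ler_wpM2l ?invr_ge0// up.
have el : (energy leb2 (levy_weight \o fst) (increment u) < +oo)%E.
  apply: energy_increment_lty => //.
  - exact: levy_weight_ge0.
  - exact: measurable_levy_weight.
  - exact: levy_weight_lty.
pose w (p : E * E) := 2 / c * (jweight \o fst) p + (levy_weight \o fst) p.
have c20 : 0 <= 2 / c by rewrite divr_ge0// ltW.
have cj0 (p : E * E) : 0 <= 2 / c * (jweight \o fst) p by rewrite mulr_ge0.
have mcj : measurable_fun setT (fun p : E * E => 2 / c * (jweight \o fst) p).
  exact: measurable_funM.
have w0 p : 0 <= w p by rewrite addr_ge0.
have mw : measurable_fun setT w by exact: measurable_funD.
apply: le_lt_trans (energy_le_weight (mu := leb2) r0 mr w0 mw mi ler01 _) _.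
  apply: aeW => -[h x]; rewrite mul1r; apply: ler_wpM2r; first exact: sqr_ge0.
  rewrite /w/=; have [h1|h1] := leP (enorm h) 1; last first.
    rewrite /levy_weight min_l ?mulr1 ?lerDr//; last by rewrite exprn_ege1// ltW.
    exact: (cj0 (h, x)).
  have [h0|h0] := boolP (0 < enorm h).
    apply: (@le_trans _ _ (2 / c * jweight h)); last by rewrite lerDl levy_weight_ge0.
    rewrite /jweight mulrA (_ : 2 / c * 2^-1 = c^-1); last by field; rewrite gt_eqF.
    rewrite ler_pdivlMl//.
    by rewrite low// h0.
  have -> : riesz_weight h = 0.
    have h00 : enorm h = 0 by apply/eqP; rewrite eq_le enorm_ge0 andbT leNgt.
    by rewrite /riesz_weight h00 powR0// oppr_eq0 gt_eqF// ltr_wpDl.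
  exact: (w0 (h, x)).
rewrite mul1e energy_add_weight//.
apply: lte_add_pinfty => //.
apply: le_lt_trans (energy_le_weight (mu := leb2) cj0 mcj j0 mj mi c20 _) _.
  by apply: aeW => p; rewrite mulrA.
by apply: lte_mul_pinfty.
Qed.

End kinetic_energy.

(** * The Schroedinger form *)

Section schrodinger.
Context {R : realType} (d : nat) (m alpha : R) (V : d.-tuple R -> R) (c : R).
Hypotheses (d0 : (0 < d)%N) (m0 : 0 <= m) (al0 : 0 < alpha) (al2 : alpha < 2).
Hypotheses (mV : measurable_fun setT V) (c0 : 0 <= c).
Hypothesis Vc : {ae leb R d, forall x, - c <= V x}.
Local Notation E := (d.-tuple R).
Local Notation C := R[i].
Local Notation leb2 := (sleb d \x sleb d)%E.
Local Notation jw := (@jweight R d m alpha \o @fst E E).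
Local Notation one := (fun=> 1 : R).
Implicit Types (u v : E -> C).

Definition shifted_potential (x : E) : R := Num.max (V x + c) 0.
Local Notation W := shifted_potential.

Lemma shifted_potential_ge0 x : 0 <= W x.
Proof. by rewrite le_max lexx orbT. Qed.

Lemma measurable_shifted_potential : measurable_fun setT W.
Proof. by apply: measurable_maxr => //; exact: measurable_funD. Qed.

Let W0 := shifted_potential_ge0.
Let mW := measurable_shifted_potential.

Let jw0 (p : E * E) : 0 <= jw p. Proof. exact: jweight_ge0. Qed.

Let mjw : measurable_fun setT jw.
Proof. exact: (measurableT_comp (measurable_jweight _ _) measurable_fst). Qed.

Let one0 (x : E) : 0 <= one x. Proof. by []. Qed.

Let mone : measurable_fun setT (one : E -> R). Proof. exact: measurable_cst. Qed.

Lemma shifted_energy_lty u : finite_energy (leb R d) one u ->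
  (\int[leb R d]_x (`|V x| * cabs (u x) ^+ 2)%:E < +oo)%E <->
  (energy (leb R d) W u < +oo)%E.
Proof.
move=> [mu eu].
have mnV : measurable_fun setT (fun x => `|V x|) by exact: measurableT_comp.
have nV0 x : 0 <= `|V x| by [].
rewrite -[X in (X < +oo)%E <-> _]/(energy (leb R d) (fun x => `|V x|) u).
have mc : measurable_fun setT (fun _ : E => c) by exact: measurable_cst.
have ce : (energy (leb R d) (fun=> c) u < +oo)%E.
  have h := energy_le_weight (mu := leb R d) (fun=> c0) mc one0 mone mu c0.
  apply: le_lt_trans (h _) _; last by apply: lte_mul_pinfty.
  by apply: aeW => x; rewrite mul1r.
have split (w : E -> R) : (forall x, 0 <= w x) -> measurable_fun setT w ->
    (energy (leb R d) w u < +oo)%E ->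
    (1%:E * energy (leb R d) (fun x => (w x + c)%R) u < +oo)%E.
  by move=> w0 mw ew; rewrite mul1e energy_add_weight//; exact: lte_add_pinfty.
split => h; apply: le_lt_trans (split _ _ _ h) => //; apply: energy_le_weight => //;
  try (by move=> x; rewrite addr_ge0); try (by apply: measurable_funD).
  apply: aeW => x; rewrite mul1r ler_wpM2r ?sqr_ge0// /W ge_max.
  by rewrite lerD2r ler_norm addr_ge0.
apply: filterS Vc => x Vx; rewrite mul1r ler_wpM2r ?sqr_ge0//.
have VW : V x + c <= W x by rewrite le_max lexx.
by rewrite ler_norml; apply/andP; split; have := W0 x; move: (c0); lra.
Qed.

Lemma form_domainP u : form_domain alpha V u <->
  [/\ finite_energy (leb R d) one u,
      finite_energy leb2 jw (increment u) & finite_energy (leb R d) W u].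
Proof.
rewrite /form_domain /Hsobolev; split.
  move=> [[/L2E fu]]; have [mu eu] := fu; rewrite /= gagliardoE// => er eV.
  split => //; split => //; first exact: cmeasurable_increment.
    exact/riesz_energy_lty.
  exact/shifted_energy_lty.
move=> [fu [mi ei] [mu eW]]; split; last exact/shifted_energy_lty.
split; first exact/L2E.
by rewrite /= gagliardoE//; apply/(riesz_energy_lty d0 m0 al0 al2 fu).
Qed.

Lemma potential_energyE u : finite_energy (leb R d) one u ->
  finite_energy (leb R d) W u ->
  (\int[leb R d]_x (V x * cabs (u x) ^+ 2)%:E =
   energy (leb R d) W u - c%:E * energy (leb R d) one u)%E.
Proof.
move=> [mu eu] [_ eW].
have int (w : E -> R) : (forall x, 0 <= w x) -> measurable_fun setT w ->
    (energy (leb R d) w u < +oo)%E ->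
    (leb R d).-integrable setT (fun x => (w x * cabs (u x) ^+ 2)%:E).
  move=> w0 mw ew; apply/integrableP; split; first exact: measurable_energy_density.
  by under eq_integral do rewrite gee0_abs ?energy_density_ge0//.
have i1 := int _ one0 mone eu.
have ic : (leb R d).-integrable setT (fun x => (c%:E * (one x * cabs (u x) ^+ 2)%:E)%E).
  exact: integrableZl.
rewrite /energy -ge0_integralZl_EFin//; last 2 first.
- by move=> x _; rewrite lee_fin mul1r sqr_ge0.
- exact: measurable_energy_density.
rewrite -integralB//; last exact: int.
apply: ae_eq_integral => //.
- by apply/measurable_EFinP; apply: measurable_funM => //; exact: measurable_cabs_sqr.
- apply: emeasurable_funB; first exact: measurable_energy_density.
  by apply: measurable_funeM; exact: measurable_energy_density.
- apply: filterS Vc => x Vx _; rewrite mul1r -EFinM -EFinB /W max_l;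
    last by rewrite -lerBlDr sub0r.
  by congr (_%:E); ring.
Qed.

Lemma schrodinger_formE u : form_domain alpha V u ->
  schrodinger_form m alpha V u =
  (energy leb2 jw (increment u) + energy (leb R d) W u -
   c%:E * energy (leb R d) one u)%E.
Proof.
move=> Du; have [fu fi fW] := (form_domainP u).1 Du; have [mu _] := fu.
rewrite /schrodinger_form asboolT// kineticE// potential_energyE// addeA//.
Qed.

Definition schrodinger_sesq u v : C :=
  cform leb2 jw (increment u) (increment v) + cform (leb R d) W u v +
  (- c)%:C%C * cform (leb R d) one u v.

Lemma schrodinger_quadratic_form :
  quadratic_form (form_domain alpha V) (schrodinger_form m alpha V).
Proof.
split.
- by move=> u [[]].
- apply/form_domainP.
  have m00 : cmeasurable (fun _ : E => 0 : C) by split.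
  have m02 : cmeasurable (increment (fun _ : E => 0 : C)) by exact: cmeasurable_increment.
  have z dT (T : measurableType dT) (mu : {measure set T -> \bar R})
      (w : T -> R) (f : T -> C) :
      (forall x, f x = 0) -> energy mu w f = 0%E.
    move=> f0; rewrite /energy; under eq_integral do rewrite f0 cabs0 expr2 !mulr0.
    by rewrite integral0.
  split; split => //; rewrite z// => x; rewrite /increment subrr//.
- move=> a u v /form_domainP[u1 u2 u3] /form_domainP[v1 v2 v3]; apply/form_domainP; split.
  + exact: finite_energy_lin.
  + by rewrite increment_lin; exact: finite_energy_lin.
  + exact: finite_energy_lin.
- exists schrodinger_sesq; split.
  + move=> a u v w /form_domainP[u1 u2 u3] /form_domainP[v1 v2 v3] /form_domainP[w1 w2 w3].
    rewrite /schrodinger_sesq increment_lin !cform_linear//.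
    by ring.
  + move=> u v _ _; rewrite /schrodinger_sesq.
    rewrite [cform leb2 jw _ _]cform_conj [cform _ W _ _]cform_conj.
    rewrite [cform _ one _ _]cform_conj.
    rewrite !rmorphD rmorphM; congr (_ + _ * _).
    by rewrite [RHS]conjcE/= oppr0.
  + move=> u Du; have [u1 u2 u3] := (form_domainP u).1 Du.
    rewrite schrodinger_formE// !energyE// /schrodinger_sesq !addcE mulcE/=.
    by rewrite -!EFinD; congr (_%:E); ring.
- by move=> u nDu; rewrite /schrodinger_form asboolF.
Qed.

Lemma schrodinger_bounded_below : bounded_below (schrodinger_form m alpha V).
Proof.
exists (- c) => u /L2E fu; rewrite L2norm_sqr.
have [Du|nDu] := pselect (form_domain alpha V u); last first.
  by rewrite /schrodinger_form asboolF// leey.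
rewrite schrodinger_formE// EFinN mulNe -[leLHS]add0e leeD2r//.
by rewrite adde_ge0// energy_ge0.
Qed.

End schrodinger.

Section lower_semicontinuity.
Context {R : realType} (d : nat) (m alpha : R) (V : d.-tuple R -> R) (c : R).
Hypotheses (d0 : (0 < d)%N) (m0 : 0 <= m) (al0 : 0 < alpha) (al2 : alpha < 2).
Hypotheses (mV : measurable_fun setT V) (c0 : 0 <= c).
Hypothesis Vc : {ae leb R d, forall x, - c <= V x}.
Local Notation E := (d.-tuple R).
Local Notation C := R[i].
Local Notation leb2 := (sleb d \x sleb d)%E.
Local Notation jw := (@jweight R d m alpha \o @fst E E).
Local Notation one := (fun=> 1 : R).
Local Notation W := (shifted_potential V c).
Implicit Types (u v : E -> C).

Lemma ae_ccvg_increment (v_ : nat -> E -> C) u :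
  {ae leb R d, forall x, ccvg (v_ ^~ x) (u x)} ->
  {ae leb2, forall p, ccvg (fun n => increment (v_ n) p) (increment u p)}.
Proof.
move=> [N [mN N0 subN]].
have null (A : set (E * E)) : measurable A ->
    (forall h, leb R d (xsection A h) = 0%E) -> leb2.-negligible A.
  move=> mA A0; exists A; split => //.
  by rewrite /product_measure1/= integral0_eq// => h _; exact: A0.
have m1 : measurable ((fun p : E * E => p.2) @^-1` N).
  by rewrite -[X in measurable X]setTI; exact: measurable_snd.
have m2 : measurable ((fun p : E * E => tadd p.2 p.1) @^-1` N).
  by rewrite -[X in measurable X]setTI; exact: measurable_shift.
have n1 : leb2.-negligible ((fun p : E * E => p.2) @^-1` N).
  apply: null => // h; rewrite (_ : xsection _ _ = N)//.
  by apply/seteqP; split => x; rewrite xsectionE.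
have n2 : leb2.-negligible ((fun p : E * E => tadd p.2 p.1) @^-1` N).
  apply: null => // h; rewrite -N0 -(leb_translate h mN); congr (leb R d _).
  by apply/seteqP; split => x; rewrite xsectionE.
apply: negligibleS (negligibleU n1 n2) => -[h x] /= ncv.
apply: contrapT => /not_orP[xN xhN]; apply: ncv.
by apply: ccvgB; apply: contrapT => ncv; [apply: xhN|apply: xN]; exact: subN.
Qed.

Lemma schrodinger_lower_semicontinuous :
  L2_lower_semicontinuous (schrodinger_form m alpha V).
Proof.
move=> u a /L2E fu aq; have [mu eu] := fu; apply: contrapT => nex.
pose e n : R := 1 / (2 ^ n.+1)%:R.
have e0 n : 0 < e n by rewrite divr_gt0// ltr0n expn_gt0.
have e1 n : e n <= 1 by rewrite ler_pdivrMr ?ltr0n ?expn_gt0// mul1r ler1n expn_gt0.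
have step n : exists v, [/\ L2 v,
    (energy (leb R d) one (fun x => (v x - u x)%R) <= (e n ^+ 2)%:E)%E &
    (schrodinger_form m alpha V v <= a%:E)%E].
  apply: contrapT => nv; apply: nex; exists (e n) => // v Lv vu.
  rewrite ltNge; apply/negP => qa; apply: nv; exists v; split => //.
  exact: energy_lt_L2norm.
have [v_ hv] := choice step.
have fv n : finite_energy (leb R d) one (v_ n) by have [/L2E] := hv n.
have mv n : cmeasurable (v_ n) by have [] := fv n.
have Dv n : form_domain alpha V (v_ n).
  have [_ _ qa] := hv n; apply: contrapT => nD.
  by move: qa; rewrite /schrodinger_form asboolF// leye_eq.
have aev : {ae leb R d, forall x, ccvg (v_ ^~ x) (u x)}.
  apply: ae_cvg_fast => // n; have [_ h _] := hv n; apply: le_trans h _.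
  by rewrite lee_fin -/(e n) expr2 ler_piMl// ltW.
have jw0 (p : E * E) : 0 <= jw p by exact: jweight_ge0.
have mjw : measurable_fun setT jw.
  exact: (measurableT_comp (measurable_jweight _ _) measurable_fst).
have W0 := shifted_potential_ge0 V c; have mW := measurable_shifted_potential c mV.
pose U := fine (energy (leb R d) one u).
have UE : energy (leb R d) one u = U%:E.
  by rewrite fineK// ge0_fin_numE//; exact: energy_ge0.
have U0 : 0 <= U by rewrite fine_ge0// energy_ge0.
have Fu : (energy leb2 jw (increment u) + energy (leb R d) W u <= (a + c * U)%:E)%E.
  have ej := energy_fatou jw0 mjw (fun n => cmeasurable_increment (mv n))
    (cmeasurable_increment mu) (ae_ccvg_increment aev).
  have eW := energy_fatou W0 mW mv mu aev.
  apply: le_trans (leeD ej eW) _.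
  apply: (@limn_einfD_le _ _ _ (fun n => a + c * (U + e n * (U + 2)))).
  - by move=> n; exact: energy_ge0.
  - by move=> n; exact: energy_ge0.
  - move=> n; have [_ vu qa] := hv n.
    have [h1 h2 h3] := (form_domainP d0 m0 al0 al2 mV c0 Vc (v_ n)).1 (Dv n).
    rewrite (schrodinger_formE d0 m0 al0 al2 mV c0 Vc (Dv n)) in qa.
    (* [|v|^2 <= (1 + e) |u|^2 + (1 + 1/e) |v - u|^2] with [|v - u| <= e] *)
    have ev : (energy (leb R d) one (v_ n) <= (U + e n * (U + 2))%:E)%E.
      have md : cmeasurable (fun x => v_ n x - u x).
        by apply: cmeasurableD => //; exact: cmeasurableN.
      have := energyD_scaled (leb R d) (fun _ : E => ler01)
        (measurable_cst (1 : R)) (e0 n) mu md.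
      rewrite [X in (X <= _)%E](_ : _ = energy (leb R d) one (v_ n)); last first.
        by apply: eq_integral => x _; rewrite addrC subrK.
      move=> /le_trans; apply; rewrite UE.
      apply: (@le_trans _ _ ((1 + e n)%:E * U%:E + (1 + (e n)^-1)%:E * (e n ^+ 2)%:E)%E).
        rewrite leeD2l// lee_wpmul2l// lee_fin addr_ge0// invr_ge0 ltW//.
      rewrite -!EFinM -EFinD lee_fin.
      rewrite (_ : (1 + (e n)^-1) * e n ^+ 2 = e n ^+ 2 + e n);
        last by field; rewrite gt_eqF.
      have : e n ^+ 2 <= e n by rewrite expr2 ler_piMl// ltW.
      lra.
    have vfin : energy (leb R d) one (v_ n) \is a fin_num.
      by rewrite ge0_fin_numE; [case: h1|exact: energy_ge0].
    rewrite leeBlDr in qa; last by rewrite fin_numM.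
    apply: le_trans qa _; rewrite EFinD leeD2l// EFinM lee_wpmul2l//.
  - rewrite -[X in _ --> _ + c * X]addr0 -[X in _ --> _ + c * (_ + X)](mul0r (U + 2)).
    apply: cvgD; first exact: cvg_cst.
    apply: cvgM; first exact: cvg_cst.
    apply: cvgD; first exact: cvg_cst.
    apply: cvgM; last exact: cvg_cst.
    have := @cvg_geometric R (2^-1) (2^-1) _.
    rewrite ger0_norm ?invr_ge0// invf_lt1// ltr1n => /(_ isT).
    apply: cvg_trans; apply: near_eq_cvg; apply: nearW => n.
    by rewrite /e /geometric/= div1r natrX exprS invfM -exprVn.
have fin := le_lt_trans Fu (ltry _).
have ej0 : (0 <= energy leb2 jw (increment u))%E by exact: energy_ge0.
have eW0 : (0 <= energy (leb R d) W u)%E by exact: energy_ge0.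
have Du : form_domain alpha V u.
  apply/(form_domainP d0 m0 al0 al2 mV c0 Vc); split => //; split => //.
  - exact: cmeasurable_increment.
  - by apply: le_lt_trans fin; rewrite leeDl.
  - by apply: le_lt_trans fin; rewrite leeDr.
move: aq; rewrite ltNge (schrodinger_formE d0 m0 al0 al2 mV c0 Vc Du) UE => /negP; apply.
by rewrite leeBlDr// -EFinM -EFinD.
Qed.

End lower_semicontinuity.

(** * Density of Lipschitz functions *)

Section lipschitz_functions.
Context {R : realType} (d : nat).
Local Notation E := (d.-tuple R).

Definition elipschitz (f : E -> R) : Prop :=
  exists2 L, 0 <= L & forall x h, `|f (tadd x h) - f x| <= L * enorm h.

Lemma dist_min_le (a b a' b' : R) :
  `|Num.min a b - Num.min a' b'| <= `|a - a'| + `|b - b'|.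
Proof.
have [] := lerP a b; have [] := lerP a' b' => ? ?.
- by rewrite lerDl.
- rewrite ler_norml; have := ler_norm (a - a'); have := ler_norm (a' - a).
  have := ler_norm (b - b'); have := ler_norm (b' - b); rewrite (distrC a') (distrC b').
  by move=> *; apply/andP; split; lra.
- rewrite ler_norml; have := ler_norm (a - a'); have := ler_norm (a' - a).
  have := ler_norm (b - b'); have := ler_norm (b' - b); rewrite (distrC a') (distrC b').
  by move=> *; apply/andP; split; lra.
- by rewrite lerDr.
Qed.

Lemma elipschitz_cst (a : R) : elipschitz (fun=> a).
Proof. by exists 0 => // x h; rewrite subrr normr0 mul0r. Qed.

Lemma elipschitz_min f g : elipschitz f -> elipschitz g ->
  elipschitz (fun x => Num.min (f x) (g x)).
Proof.
move=> [L L0 fL] [M M0 gM]; exists (L + M); first exact: addr_ge0.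
move=> x h; apply: le_trans (dist_min_le _ _ _ _) _.
by rewrite mulrDl lerD.
Qed.

Lemma elipschitzZ (a : R) f : elipschitz f -> elipschitz (fun x => a * f x).
Proof.
move=> [L L0 fL]; exists (`|a| * L); first exact: mulr_ge0.
by move=> x h; rewrite -mulrBr normrM -mulrA ler_wpM2l.
Qed.

Lemma elipschitzD f g : elipschitz f -> elipschitz g -> elipschitz (fun x => f x + g x).
Proof.
move=> [L L0 fL] [M M0 gM]; exists (L + M); first exact: addr_ge0.
move=> x h; rewrite opprD addrACA mulrDl.
by apply: le_trans (ler_normD _ _) _; exact: lerD.
Qed.

Lemma elipschitz_max f g : elipschitz f -> elipschitz g ->
  elipschitz (fun x => Num.max (f x) (g x)).
Proof.
move=> lf lg.
have -> : (fun x => Num.max (f x) (g x)) = fun x => -1 * Num.min (-1 * f x) (-1 * g x).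
  by apply/funext => x; rewrite !mulN1r oppr_min !opprK.
by apply/elipschitzZ/elipschitz_min; exact: elipschitzZ.
Qed.

Lemma elipschitz_tnth i : elipschitz (fun x => tnth x i).
Proof.
by exists 1 => // x h; rewrite tnth_mktuple addrC addKr mul1r ler_tnth_enorm.
Qed.

Lemma elipschitz_l1 : elipschitz (fun x => \sum_(i < d) `|tnth x i|).
Proof.
exists d%:R => // x h; rewrite -sumrB; apply: le_trans (ler_norm_sum _ _ _) _.
apply: (@le_trans _ _ (\sum_(i < d) enorm h));
  last by rewrite sumr_const card_ord mulr_natl.
apply: ler_sum => i _; apply: le_trans (ler_dist_dist _ _) _.
by rewrite tnth_mktuple addrC addKr ler_tnth_enorm.
Qed.

End lipschitz_functions.

Section density.
Context {R : realType} (d : nat).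
Local Notation E := (d.-tuple R).
Local Notation C := R[i].
Local Notation leb := (leb R d).
Local Notation one := (fun=> 1 : R).
Variable D : set (E -> C).
Hypothesis Dmeas : forall u, D u -> cmeasurable u.
Hypothesis Dlin : forall (a : C) u v, D u -> D v -> D (fun x => a * u x + v x).
Hypothesis Dlip : forall f : E -> R, measurable_fun setT f -> elipschitz f ->
  (forall x, 0 <= f x <= 1) ->
  (exists n : nat, forall x, f x != 0 -> @cube R d n%:R x) ->
  D (fun x => (f x)%:C%C).

Definition approximable (g : E -> C) : Prop := forall e : R, 0 < e ->
  exists2 v, D v & (energy leb one (fun x => (v x - g x)%R) <= e%:E)%E.

Let one0 (x : E) : 0 <= one x. Proof. by []. Qed.
Let mone : measurable_fun setT (one : E -> R). Proof. exact: measurable_cst. Qed.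

Lemma approximable_lin (a : C) f g : cmeasurable f -> cmeasurable g ->
  approximable f -> approximable g -> approximable (fun x => a * f x + g x).
Proof.
move=> mf mg af ag e e0.
pose k := cabs a ^+ 2; have k0 : 0 <= k by exact: sqr_ge0.
have k1 : 0 < 4 * (k + 1) by lra.
have [v Dv ev] := af (e / (4 * (k + 1))) (divr_gt0 e0 k1).
have [w Dw ew] := ag (e / 4) (divr_gt0 e0 (ltr0n R 4)).
exists (fun x => a * v x + w x); first exact: Dlin.
have mvf : cmeasurable (fun x => v x - f x).
  by apply: cmeasurableD; [exact: Dmeas|exact: cmeasurableN].
have mwg : cmeasurable (fun x => w x - g x).
  by apply: cmeasurableD; [exact: Dmeas|exact: cmeasurableN].
have -> : (fun x => a * v x + w x - (a * f x + g x)) =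
    fun x => a * (v x - f x) + (w x - g x) by apply/funext => x; ring.
apply: le_trans (energyD leb one0 mone (cmeasurableZ a mvf) mwg) _.
rewrite energyZ// -/k.
apply: (@le_trans _ _ (2%:E * (k%:E * (e / (4 * (k + 1)))%:E) + 2%:E * (e / 4)%:E)%E).
  by apply: leeD; rewrite lee_wpmul2l// lee_wpmul2l.
rewrite -!EFinM -EFinD lee_fin.
have : k * (e / (4 * (k + 1))) <= e / 4.
  by rewrite mulrA ler_pdivrMr//; lra.
lra.
Qed.

Lemma approximable_cvg (g_ : nat -> E -> C) (g : E -> C) (G : E -> R) :
  (forall k, cmeasurable (g_ k)) -> cmeasurable g ->
  (forall k, approximable (g_ k)) ->
  leb.-integrable setT (EFin \o G) ->
  (forall k x, cabs (g_ k x - g x) ^+ 2 <= G x) ->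
  (forall x, (fun k => cabs (g_ k x - g x) ^+ 2) @ \oo --> (0 : R)) ->
  approximable g.
Proof.
move=> mg_ mg ag_ iG gG gc e e0.
have md k : cmeasurable (fun x => g_ k x - g x).
  by apply: cmeasurableD => //; exact: cmeasurableN.
have : (fun k => energy leb one (fun x => (g_ k x - g x)%R)) @ \oo --> 0%E.
  rewrite [X in _ --> X](_ : _ = (\int[leb]_x cst 0%E x)%E); last by rewrite integral0.
  apply: (@dominated_cvg _ _ _ leb setT measurableT _ _ (EFin \o G)) => //.
  - by move=> k; exact: measurable_energy_density.
  - move=> x _; under eq_fun do rewrite mul1r.
    by apply: cvg_EFin; [exact: nearW|exact: gc].
  - by move=> k x _; rewrite mul1r gee0_abs lee_fin ?sqr_ge0.
have e4 : 0 < e / 4 by exact: divr_gt0.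
move=> /fine_cvgP[fin /cvgrPdist_le/(_ _ e4)] small.
have [k [kfin kle]] : exists k,
    energy leb one (fun x => (g_ k x - g x)%R) \is a fin_num /\
    `|0 - fine (energy leb one (fun x => (g_ k x - g x)%R))| <= e / 4.
  have [N _ hN] := filterI fin small.
  by exists N; have [] := hN N (leqnn N).
have ek : (energy leb one (fun x => (g_ k x - g x)%R) <= (e / 4)%:E)%E.
  rewrite -(fineK kfin) lee_fin; move: kle.
  by rewrite sub0r normrN => /(le_trans (ler_norm _)).
have [v Dv ev] := ag_ k _ e4; exists v => //.
have -> : (fun x => v x - g x) = fun x => (v x - g_ k x) + (g_ k x - g x).
  by apply/funext => x; ring.
have mvg : cmeasurable (fun x => v x - g_ k x).
  by apply: cmeasurableD; [exact: Dmeas|exact: cmeasurableN].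
apply: le_trans (energyD leb one0 mone mvg (md k)) _.
apply: (@le_trans _ _ (2%:E * (e / 4)%:E + 2%:E * (e / 4)%:E)%E).
  by apply: leeD; rewrite lee_wpmul2l.
by rewrite -!EFinM -EFinD lee_fin; lra.
Qed.

Definition rapproximable (g : E -> R) := approximable (fun x => (g x)%:C%C).

Lemma cmeasurable_real (g : E -> R) : measurable_fun setT g ->
  cmeasurable (fun x => (g x)%:C%C).
Proof. by move=> mg; split. Qed.

Lemma cabs_real (a : R) : cabs (a%:C%C) ^+ 2 = a ^+ 2.
Proof. by rewrite cabs_sqr/= expr0n addr0. Qed.

Lemma rapproximable_lin (a : R) (f g : E -> R) :
  measurable_fun setT f -> measurable_fun setT g ->
  rapproximable f -> rapproximable g -> rapproximable (fun x => a * f x + g x).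
Proof.
move=> mf mg af ag.
have := @approximable_lin (a%:C%C) _ _ (cmeasurable_real mf) (cmeasurable_real mg) af ag.
rewrite /rapproximable; congr approximable.
by apply/funext => x; rewrite -rmorphM -rmorphD.
Qed.

Lemma rapproximable_cvg (g_ : nat -> E -> R) (g G : E -> R) :
  (forall k, measurable_fun setT (g_ k)) -> measurable_fun setT g ->
  (forall k, rapproximable (g_ k)) ->
  leb.-integrable setT (EFin \o G) ->
  (forall k x, (g_ k x - g x) ^+ 2 <= G x) ->
  (forall x, (fun k => g_ k x) @ \oo --> g x) ->
  rapproximable g.
Proof.
move=> mg_ mg ag_ iG gG gc.
apply: (@approximable_cvg (fun k x => (g_ k x)%:C%C) _ G).
- by move=> k; exact: cmeasurable_real.
- exact: cmeasurable_real.
- exact: ag_.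
- exact: iG.
- by move=> k x; rewrite -rmorphB cabs_real.
- move=> x; under eq_fun do rewrite -rmorphB cabs_real expr2.
  rewrite -(mulr0 0); apply: cvgM; rewrite -(subrr (g x));
    by apply: cvgB => //; exact: cvg_cst.
Qed.

Let l1 (x : E) := \sum_(i < d) `|tnth x i|.

(* The l^1 norm is Lipschitz for [enorm] by a coordinatewise estimate, without
   the triangle inequality of [enorm]. *)
Definition diamond (n : nat) : set E := [set x | 0 < n%:R - l1 x].

Let ml1 : measurable_fun setT l1.
Proof.
by apply: measurable_sum => i; apply: measurableT_comp => //; exact: measurable_tnth.
Qed.

Let mdl n : measurable_fun setT (fun x => n%:R - l1 x).
Proof. exact: measurable_funB. Qed.

Let ldl n : elipschitz (fun x => n%:R - l1 x).
Proof.
under eq_fun do rewrite -mulN1r.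
by apply: elipschitzD; [exact: elipschitz_cst|apply: elipschitzZ; exact: elipschitz_l1].
Qed.

Lemma measurable_positive (f : E -> R) : measurable_fun setT f ->
  measurable [set x | 0 < f x].
Proof.
move=> mf; rewrite -[X in measurable X]setTI.
exact: (measurable_fun_ltr (measurable_cst _) mf).
Qed.

Lemma measurable_diamond n : measurable (diamond n).
Proof. exact: measurable_positive. Qed.

Lemma diamond_cube n x : diamond n x -> @cube R d n%:R x.
Proof.
rewrite /diamond/= subr_gt0 => /ltW xn i; rewrite /= in_itv/= -ler_norml.
by apply: le_trans xn; rewrite /l1 (bigD1 i)//= lerDl sumr_ge0.
Qed.

Lemma integrable_diamond n : leb.-integrable setT (EFin \o \1_(diamond n)).
Proof.
have md := measurable_diamond n.
apply/integrableP; split; first by apply/measurable_EFinP; exact: measurable_indic.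
under eq_integral do rewrite /= ger0_norm//.
rewrite integral_indic// setIT.
apply: le_lt_trans (_ : (leb (@cube R d n%:R) < +oo)%E).
  apply: le_measure; rewrite ?inE; [exact: measurable_diamond|exact: measurable_cube|].
  exact: diamond_cube.
by rewrite leb_cube// ltry.
Qed.

Lemma indic_sqr_le (B : set E) (a b : R) x : 0 <= a <= \1_B x ->
  0 <= b <= \1_B x -> (a - b) ^+ 2 <= \1_B x.
Proof.
rewrite indicE; case: (x \in B) => /= /andP[a0 a1] /andP[b0 b1].
  rewrite -[leRHS](expr1n _ 2) -real_normK ?num_real// lerXn2r ?nnegrE//.
  by rewrite ler_norml; apply/andP; split; lra.
have -> : a = 0 by apply/eqP; rewrite eq_le a0 a1.
by have -> : b = 0; [apply/eqP; rewrite eq_le b0 b1|rewrite subrr expr2 mulr0].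
Qed.

Lemma indic_setI01 (A B : set E) x : 0 <= (\1_(A `&` B) x : R) <= \1_B x.
Proof.
rewrite !indicE in_setI ler0n/= ler_nat.
by case: (x \in B); case: (x \in A).
Qed.

Definition elipschitz_sets : set (set E) :=
  [set A | exists2 f : E -> R, measurable_fun setT f /\ elipschitz f &
    A = [set x | 0 < f x]].

Lemma measurable_lipschitz_sets : @measurable _ E = <<s elipschitz_sets >>.
Proof.
apply/seteqP; split; last first.
  apply: smallest_sub; first exact: sigma_algebra_measurable.
  by move=> _ [f [mf _] ->]; exact: measurable_positive.
pose T := g_sigma_algebraType elipschitz_sets.
have mid : measurable_fun setT (id : T -> E).
  apply/measurable_fun_tnthP => i.
  apply: (measurability _ (RGenOInfty.measurableE R)) => _ [_ [a ->] <-].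
  apply: sub_sigma_algebra; exists (fun x : E => tnth x i + - a).
    split; first by apply: measurable_funD => //; exact: measurable_tnth.
    by apply: elipschitzD; [exact: elipschitz_tnth|exact: elipschitz_cst].
  apply/seteqP; split => x; rewrite /= in_itv/= andbT subr_gt0; first by case.
  by split.
by move=> A mA; have := mid measurableT A mA; rewrite setTI.
Qed.

Lemma setI_closed_lipschitz_sets : setI_closed elipschitz_sets.
Proof.
move=> _ _ [f [mf lf] ->] [g [mg lg] ->].
exists (fun x => Num.min (f x) (g x)).
  by split; [exact: measurable_minr|exact: elipschitz_min].
by apply/seteqP; split => x /=; rewrite lt_min => /andP.
Qed.

Let P (A : set E) := forall n, rapproximable (\1_(A `&` diamond n)).

(* The indicator of {f > 0} is the limit of the functions [min (k f^+) 1]. *)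
Lemma rapproximable_positive (f : E -> R) n : measurable_fun setT f ->
  elipschitz f -> rapproximable (\1_([set x | 0 < f x] `&` diamond n)).
Proof.
move=> mf lf.
pose g x := Num.max (Num.min (f x) (n%:R - l1 x)) 0.
pose phi k x : R := Num.min (k%:R * g x) 1.
have mg : measurable_fun setT g.
  by apply: measurable_maxr => //; exact: measurable_minr.
have g0 x : 0 <= g x by rewrite le_max lexx orbT.
have mphi k : measurable_fun setT (phi k).
  by apply: measurable_minr => //; exact: measurable_funM.
have phi01 k x : 0 <= phi k x <= 1.
  by rewrite ge_min lexx orbT andbT le_min ler01 mulr_ge0.
have gP x : (0 < g x) = (x \in [set x | 0 < f x] `&` diamond n).
  rewrite lt_max ltxx orbF lt_min; apply/idP/idP.
    by move=> /andP[fx lx]; apply/mem_set.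
  by move=> /set_mem[fx lx]; rewrite fx.
have phiB k x : 0 <= phi k x <= \1_(diamond n) x.
  have /andP[p0 p1] := phi01 k x; rewrite p0 indicE/=.
  have [//|/negP xn] := boolP (x \in diamond n).
  have -> : phi k x = 0; last by [].
  have gx : g x = 0.
    apply/eqP; rewrite eq_le g0 andbT leNgt gP; apply/negP => /set_mem[_ xd].
    by apply: xn; exact: mem_set.
  by rewrite /phi gx mulr0 min_l.
apply: (@rapproximable_cvg phi _ (\1_(diamond n))).
- exact: mphi.
- apply: measurable_indic; apply: measurableI; last exact: measurable_diamond.
  exact: measurable_positive.
- move=> k; have Dphi : D (fun x => (phi k x)%:C%C).
    apply: Dlip => //.
      apply: elipschitz_min; last exact: elipschitz_cst.
      apply: elipschitzZ; apply: elipschitz_max; last exact: elipschitz_cst.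
      exact: elipschitz_min.
    exists n => x phix; apply: diamond_cube; apply: contrapT => xn.
    move/eqP : phix; apply; have := phiB k x; rewrite indicE memNset// => /andP[? ?].
    by apply/eqP; rewrite eq_le; apply/andP.
  move=> e e0; exists (fun x => (phi k x)%:C%C) => //.
  rewrite /energy; under eq_integral do rewrite subrr cabs0 expr2 !mulr0.
  by rewrite integral0 lee_fin ltW.
- exact: integrable_diamond.
- move=> k x; apply: indic_sqr_le; [exact: phiB|exact: indic_setI01].
- move=> x; rewrite indicE -gP; have [gx|gx] := boolP (0 < g x); last first.
    have g00 : g x = 0 by apply/eqP; rewrite eq_le g0 andbT leNgt.
    rewrite /phi g00; under eq_fun do rewrite mulr0 min_l//.
    exact: cvg_cst.
  apply: cvg_near_cst; near=> k; rewrite /phi min_r//.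
  rewrite -ler_pdivrMr// mul1r.
  by near: k; exact: nbhs_infty_ger.
Unshelve. all: by end_near. Qed.

Lemma rapproximable_indic (A : set E) n : measurable A ->
  rapproximable (\1_(A `&` diamond n)).
Proof.
move=> mA; suff : P A by apply.
have mI (B : set E) k : measurable B -> measurable_fun setT (\1_(B `&` diamond k) : E -> R).
  move=> mB; apply: measurable_indic; apply: measurableI => //.
  exact: measurable_diamond.
have PT : P setT.
  move=> k; rewrite (_ : setT = [set x : E | 0 < (1 : R)]).
    by apply: rapproximable_positive; [exact: measurable_cst|exact: elipschitz_cst].
  by apply/seteqP; split => x //= _; exact: ltr01.
apply: (dynkin_induction (G := elipschitz_sets)).
- exact: measurable_lipschitz_sets.
- exact: setI_closed_lipschitz_sets.
- exact: PT.
- by move=> _ [f [mf lf] ->] k; exact: rapproximable_positive.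
- move=> B mB PB k.
  rewrite (_ : \1_(~` B `&` diamond k) = fun x =>
      -1 * \1_(B `&` diamond k) x + \1_(setT `&` diamond k) x).
    by apply: rapproximable_lin; [exact: mI|exact: mI|exact: PB|exact: PT].
  apply/funext => x; rewrite !indicE !in_setI in_setC in_setT/=.
  by case: (x \in B); case: (x \in diamond k) => /=; ring.
- move=> F mF tF PF k.
  pose g N x : R := \sum_(i < N) \1_(F i `&` diamond k) x.
  have mg N : measurable_fun setT (g N) by apply: measurable_sum => i; exact: mI.
  have gE N x : g N x = \1_((\big[setU/set0]_(i < N) F i) `&` diamond k) x.
    elim: N => [|N IH]; first by rewrite /g !big_ord0 set0I indic0.
    rewrite /g !big_ord_recr/= -/(g N x) IH !indicE !in_setI in_setU.
    have [xN|] := boolP (x \in F N); last by rewrite orbF addr0.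
    suff -> : (x \in \big[setU/set0]_(i < N) F i) = false by rewrite add0r.
    apply/negP => /set_mem; rewrite -bigcup_mkord => -[i /= iN xi].
    have iE := tF i N Logic.I Logic.I (ex_intro _ x (conj xi (set_mem xN))).
    by rewrite iE ltnn in iN.
  apply: (@rapproximable_cvg g _ (\1_(diamond k))).
  + exact: mg.
  + by apply: mI; exact: bigcup_measurable.
  + elim => [|N IH].
      rewrite (_ : g 0%N = fun x =>
          -1 * \1_(setT `&` diamond k) x + \1_(setT `&` diamond k) x).
        by apply: rapproximable_lin; [exact: mI|exact: mI|exact: PT|exact: PT].
      by apply/funext => x; rewrite /g big_ord0; ring.
    rewrite (_ : g N.+1 = fun x => 1 * \1_(F N `&` diamond k) x + g N x).
      by apply: rapproximable_lin; [exact: mI|exact: mg|exact: PF|exact: IH].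
    by apply/funext => x; rewrite /g big_ord_recr/= mul1r addrC.
  + exact: integrable_diamond.
  + by move=> N x; rewrite gE; apply: indic_sqr_le; exact: indic_setI01.
  + move=> x; under eq_fun do rewrite gE indicE in_setI.
    rewrite indicE in_setI; have [xU|xU] := boolP (x \in \bigcup_i F i); last first.
      rewrite (_ : (fun _ => _) = fun=> 0) ?mulr0; first exact: cvg_cst.
      apply/funext => N; rewrite (_ : (x \in _) = false)//.
      apply/negP => /set_mem; rewrite -bigcup_mkord => -[i _ xi].
      by move/negP : xU; apply; apply/mem_set; exists i.
    have [i _ xi] := set_mem xU.
    apply: cvg_near_cst; near=> N.
    rewrite (_ : (x \in \big[setU/set0]_(i < N) F i) = true)//.
    apply/mem_set; rewrite -bigcup_mkord; exists i => //=.
    by near: N; exact: nbhs_infty_gt.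
- by rewrite -measurable_lipschitz_sets.
Unshelve. all: by end_near. Qed.

Import HBNNSimple.

Lemma rapproximable_ge0 (f : E -> R) : measurable_fun setT f -> (forall x, 0 <= f x) ->
  (\int[leb]_x (f x ^+ 2)%:E < +oo)%E -> rapproximable f.
Proof.
move=> mf f0 intf.
have mEf : measurable_fun setT (EFin \o f) by exact/measurable_EFinP.
have Ef0 x : setT x -> (0 <= (EFin \o f) x)%E by rewrite /= lee_fin.
pose s := nnsfun_approx measurableT mEf.
pose g k x := s k x * \1_(diamond k) x.
have sc x : (fun k => s k x) @ \oo --> f x.
  have := cvg_nnsfun_approx measurableT mEf Ef0 (x := x) Logic.I.
  by move=> /fine_cvg.
have sle k x : s k x <= f x.
  have nd := nd_nnsfun_approx measurableT mEf.
  have cv : cvgn (fun k => s k x) by apply: cvgP; exact: sc.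
  rewrite -(cvg_lim _ (sc x))//; apply: nondecreasing_cvgn_le => // a b ab.
  by have /lefP := nd a b ab.
have mg k : measurable_fun setT (g k).
  by apply: measurable_funM => //; apply: measurable_indic; exact: measurable_diamond.
apply: (@rapproximable_cvg g _ (fun x => f x ^+ 2)) => //.
- move=> k.
  have -> : g k = fun x => \sum_(y <- finmap.enum_fset (fset_set (range (s k))))
      y * \1_((s k @^-1` [set y]) `&` diamond k) x.
    apply/funext => x; rewrite /g fimfunE fsbig_finite//= big_distrl/=; apply: eq_bigr => y _.
    by rewrite -mulrA indicI.
  have mI y : measurable_fun setT (\1_((s k @^-1` [set y]) `&` diamond k) : E -> R).
    by apply: measurable_indic; apply: measurableI => //; exact: measurable_diamond.
  elim: (finmap.enum_fset _) => [|y r IH].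
    have z := @rapproximable_indic set0 0 measurable0.
    have := @rapproximable_lin 0 _ _ (measurable_indic measurable0)
      (measurable_indic measurable0).
    move: z; rewrite set0I indic0 => z /(_ z z); congr rapproximable.
    by apply/funext => x; rewrite big_nil mul0r add0r.
  under [X in rapproximable X]eq_fun do rewrite big_cons.
  apply: rapproximable_lin => //.
    by apply: measurable_sum => z; exact: measurable_funM.
  exact: rapproximable_indic.
- apply/integrableP; split; first by apply/measurable_EFinP; exact: measurable_funX.
  by under eq_integral do rewrite /= ger0_norm ?sqr_ge0//.
- move=> k x; have := sle k x; have s0 : 0 <= s k x by [].
  rewrite /g indicE; case: (x \in diamond k); rewrite ?mulr1 ?mulr0 => sf;
    last by rewrite sub0r sqrrN.
  by rewrite -real_normK ?num_real// lerXn2r ?nnegrE// ler_norml; apply/andP; split; lra.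
- move=> x; apply: cvg_trans (sc x); apply: near_eq_cvg; near=> k.
  rewrite /g indicE mem_set ?mulr1// /diamond/= subr_gt0.
  by near: k; exact: nbhs_infty_gtr.
Unshelve. all: by end_near. Qed.

Lemma rapproximable_sqr_integrable (f : E -> R) : measurable_fun setT f ->
  (\int[leb]_x (f x ^+ 2)%:E < +oo)%E -> rapproximable f.
Proof.
move=> mf intf.
have le (g : E -> R) : measurable_fun setT g -> (forall x, g x ^+ 2 <= f x ^+ 2) ->
    (\int[leb]_x (g x ^+ 2)%:E < +oo)%E.
  move=> mg gf; apply: le_lt_trans intf; apply: ge0_le_integral => //.
  - by move=> x _; rewrite lee_fin sqr_ge0.
  - by apply/measurable_EFinP; exact: measurable_funX.
  - by apply/measurable_EFinP; exact: measurable_funX.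
  - by move=> x _; rewrite lee_fin.
have max2 (a : R) : Num.max a 0 ^+ 2 <= a ^+ 2.
  by have [a0|a0] := leP a 0; rewrite ?expr0n ?sqr_ge0.
pose g x := Num.max (- f x) 0; pose h x := Num.max (f x) 0.
have mg : measurable_fun setT g by apply: measurable_maxr => //; exact: measurableT_comp.
have mh : measurable_fun setT h by exact: measurable_maxr.
have -> : f = fun x => -1 * g x + h x.
  apply/funext => x; rewrite /g /h.
  by case: (lerP (f x) 0) => ?; case: (lerP (- f x) 0) => ?; lra.
apply: rapproximable_lin => //; apply: rapproximable_ge0 => //.
- by move=> x; rewrite le_max lexx orbT.
- by apply: le => // x; rewrite -[leRHS]sqrrN max2.
- by move=> x; rewrite le_max lexx orbT.
- by apply: le => // x; exact: max2.
Qed.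

Lemma approximable_L2 u : finite_energy leb one u -> approximable u.
Proof.
move=> [[mr mi] eu].
have le (g : E -> R) : measurable_fun setT g -> (forall x, g x ^+ 2 <= cabs (u x) ^+ 2) ->
    (\int[leb]_x (g x ^+ 2)%:E < +oo)%E.
  move=> mg gf; apply: le_lt_trans eu; apply: ge0_le_integral => //.
  - by move=> x _; rewrite lee_fin sqr_ge0.
  - by apply/measurable_EFinP; exact: measurable_funX.
  - by apply: measurable_energy_density.
  - by move=> x _; rewrite lee_fin mul1r.
have ar : rapproximable (fun x => complex.Re (u x)).
  apply: rapproximable_sqr_integrable => //; apply: le => // x.
  by rewrite cabs_sqr lerDl sqr_ge0.
have ai : rapproximable (fun x => complex.Im (u x)).
  apply: rapproximable_sqr_integrable => //; apply: le => // x.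
  by rewrite cabs_sqr lerDr sqr_ge0.
have -> : u = fun x => 'i%C * (complex.Im (u x))%:C%C + (complex.Re (u x))%:C%C.
  by apply/funext => x; rewrite addrC -complexE.
by apply: approximable_lin => //; exact: cmeasurable_real.
Qed.

End density.

(** * Density of the form domain *)

Section test_functions.
Context {R : realType} (d : nat) (m alpha : R) (V : d.-tuple R -> R) (c : R).
Hypotheses (d0 : (0 < d)%N) (m0 : 0 <= m) (al0 : 0 < alpha) (al2 : alpha < 2).
Hypotheses (mV : measurable_fun setT V) (c0 : 0 <= c).
Hypothesis Vc : {ae leb R d, forall x, - c <= V x}.
Hypothesis Vloc : forall n : nat,
  (\int[leb R d]_x (`|V x| * \1_(@cube R d n%:R) x)%:E < +oo)%E.
Local Notation E := (d.-tuple R).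
Local Notation C := R[i].
Local Notation leb2 := (sleb d \x sleb d)%E.
Local Notation one := (fun=> 1 : R).

Lemma finite_energy_cube n :
  finite_energy (leb R d) one (fun x => (\1_(@cube R d n%:R) x)%:C%C).
Proof.
have mc := @measurable_cube R d n%:R.
split; first by apply: cmeasurable_real; exact: measurable_indic.
rewrite /energy (_ : (\int[_]_x _)%E = (\int[leb R d]_x (\1_(@cube R d n%:R) x)%:E)%E).
  by rewrite integral_indic// setIT leb_cube// ltry.
apply: eq_integral => x _; rewrite cabs_real mul1r indicE.
by case: (_ \in _); rewrite expr2 ?mulr1 ?mulr0.
Qed.

Lemma lipschitz_form_domain (f : E -> R) : measurable_fun setT f -> elipschitz f ->
  (forall x, 0 <= f x <= 1) ->
  (exists n : nat, forall x, f x != 0 -> @cube R d n%:R x) ->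
  form_domain alpha V (fun x => (f x)%:C%C).
Proof.
move=> mf [L L0 fL] f01 [n fn].
pose chi x : C := (\1_(@cube R d n%:R) x)%:C%C.
have [mchi echi] := finite_energy_cube n.
have mcf := cmeasurable_real mf.
have chi01 x : cabs (chi x) ^+ 2 = \1_(@cube R d n%:R) x.
  rewrite cabs_real indicE.
  by case: (_ \in _); rewrite expr2 ?mulr1 ?mulr0.
have fchi x : f x ^+ 2 <= \1_(@cube R d n%:R) x.
  have /andP[f0 f1] := f01 x.
  have [fx|fx] := eqVneq (f x) 0; first by rewrite fx expr2 mulr0 indicE ler0n.
  by rewrite indicE mem_set ?exprn_ile1//; exact: fn.
have fone : finite_energy (leb R d) one (fun x => (f x)%:C%C).
  split => //; apply: le_lt_trans echi; apply: ge0_le_integral => //.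
  - by move=> x _; rewrite lee_fin mul1r sqr_ge0.
  - exact: measurable_energy_density.
  - exact: measurable_energy_density.
  - by move=> x _; rewrite lee_fin !mul1r -/(chi x) chi01 cabs_real.
have mi := cmeasurable_increment mcf.
apply/(form_domainP d0 m0 al0 al2 mV c0 Vc); split => //; split => //.
- apply/(riesz_energy_lty d0 m0 al0 al2 fone).
  have ml : measurable_fun setT (levy_weight alpha \o @fst E E).
    exact: (measurableT_comp (@measurable_levy_weight R d alpha) measurable_fst).
  have mr : measurable_fun setT (riesz_weight alpha \o @fst E E).
    exact: (measurableT_comp (@measurable_riesz_weight R d alpha) measurable_fst).
  have l0 (p : E * E) : 0 <= (levy_weight alpha \o fst) p by exact: levy_weight_ge0.
  have r0 (p : E * E) : 0 <= (riesz_weight alpha \o fst) p by exact: riesz_weight_ge0.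
  pose K := 1 + L ^+ 2; have K0 : 0 <= K by rewrite addr_ge0 ?sqr_ge0.
  have m1 := cmeasurable_comp (@measurable_shift R d) mchi.
  have m2 := cmeasurable_comp (@measurable_snd _ _ E E) mchi.
  have fin (g : E * E -> E) (mg : cmeasurable (chi \o g)) :
      energy leb2 (levy_weight alpha \o fst) (chi \o g) =
        (\int[leb R d]_h (levy_weight alpha h)%:E * energy (leb R d) one chi)%E ->
      (K%:E * energy leb2 (levy_weight alpha \o fst) (chi \o g) < +oo)%E.
    move=> ->; apply: lte_mul_pinfty => //.
    apply: lte_mul_pinfty => //.
    + by apply: integral_ge0 => x _; rewrite lee_fin levy_weight_ge0.
    + rewrite ge0_fin_numE ?levy_weight_lty//.
      by apply: integral_ge0 => x _; rewrite lee_fin levy_weight_ge0.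
  have e1 := fin _ m1 (energy_shift (@levy_weight_ge0 R d alpha)
    (@measurable_levy_weight R d alpha) mchi).
  have e2 := fin _ m2 (energy_fst (@levy_weight_ge0 R d alpha)
    (@measurable_levy_weight R d alpha) mchi).
  apply: le_lt_trans (lte_add_pinfty e1 e2).
  have md (g : E * E -> E) : cmeasurable (chi \o g) ->
      measurable_fun setT
        (fun p => ((levy_weight alpha \o fst) p * cabs ((chi \o g) p) ^+ 2)%:E).
    by move=> mg; exact: measurable_energy_density.
  have d0' (g : E * E -> E) p :
      (0 <= ((levy_weight alpha \o fst) p * cabs ((chi \o g) p) ^+ 2)%:E)%E.
    by rewrite lee_fin; exact: (mulr_ge0 (l0 _) (sqr_ge0 _)).
  rewrite /energy -(ge0_integralZl_EFin _ measurableT _ (md _ m1) K0);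
    last by move=> p _; exact: d0'.
  rewrite -(ge0_integralZl_EFin _ measurableT _ (md _ m2) K0);
    last by move=> p _; exact: d0'.
  rewrite -ge0_integralD//; last 4 first.
  + by move=> p _; apply: mule_ge0 => //; exact: d0'.
  + by apply: measurable_funeM; exact: md.
  + by move=> p _; apply: mule_ge0 => //; exact: d0'.
  + by apply: measurable_funeM; exact: md.
  apply: ge0_le_integral.
  + by [].
  + by move=> p _; rewrite lee_fin; exact: (mulr_ge0 (r0 _) (sqr_ge0 _)).
  + exact: measurable_energy_density.
  + by apply: emeasurable_funD; apply: measurable_funeM; exact: md.
  + move=> [h x] _; rewrite -!EFinM -EFinD lee_fin /= !chi01 -!mulrDr.
    rewrite /increment/= -rmorphB cabs_real /levy_weight.
    rewrite [leRHS]mulrCA -[leRHS]mulrA; apply: ler_wpM2l; first exact: riesz_weight_ge0.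
    have i0 y : 0 <= \1_(@cube R d n%:R) y :> R by rewrite indicE ler0n.
    set D := f (tadd x h) - f x.
    have Dmin : D ^+ 2 <= K * Num.min 1 (enorm h ^+ 2).
      have [h1|h1] := leP 1 (enorm h ^+ 2).
        rewrite mulr1; apply: (@le_trans _ _ 1); last by rewrite lerDl sqr_ge0.
        rewrite -real_normK ?num_real// exprn_ile1//.
        have /andP[? ?] := f01 x; have /andP[? ?] := f01 (tadd x h).
        by rewrite ler_norml /D; apply/andP; split; lra.
      apply: (@le_trans _ _ (L ^+ 2 * enorm h ^+ 2)).
        rewrite -exprMn -real_normK ?num_real// lerXn2r ?nnegrE ?mulr_ge0 ?enorm_ge0//.
        exact: fL.
      by rewrite ler_wpM2r ?sqr_ge0// lerDr.
    have [fx|fx] := eqVneq (f x) 0; last first.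
      rewrite [\1_ _ x]indicE (mem_set (fn _ fx)).
      have mK : 0 <= Num.min 1 (enorm h ^+ 2) by rewrite le_min ler01 sqr_ge0.
      apply: le_trans Dmin _; rewrite [leRHS]mulrCA [leRHS]mulrA ler_peMr ?mulr_ge0//.
      by rewrite lerDr.
    have [fxh|fxh] := eqVneq (f (tadd x h)) 0.
      rewrite /D fx fxh subrr expr2 mul0r mulr_ge0 ?le_min ?ler01 ?sqr_ge0//.
      by rewrite mulr_ge0// addr_ge0.
    rewrite [\1_ _ (tadd x h)]indicE (mem_set (fn _ fxh)).
    have mK : 0 <= Num.min 1 (enorm h ^+ 2) by rewrite le_min ler01 sqr_ge0.
    apply: le_trans Dmin _; rewrite [leRHS]mulrCA [leRHS]mulrA ler_peMr ?mulr_ge0//.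
    by rewrite lerDl.
- apply/(shifted_energy_lty mV c0 Vc fone); apply: le_lt_trans (Vloc n).
  have mnV : measurable_fun setT (fun x => `|V x|) by exact: measurableT_comp.
  apply: ge0_le_integral => //.
  + by move=> x _; rewrite lee_fin mulr_ge0// sqr_ge0.
  + apply/measurable_EFinP; apply: measurable_funM => //; exact: measurable_cabs_sqr.
  + apply/measurable_EFinP; apply: measurable_funM => //.
    by apply: measurable_indic; exact: measurable_cube.
  + by move=> x _; rewrite lee_fin ler_wpM2l// cabs_real.
Qed.

Lemma form_domain_dense : L2dense (form_domain alpha V).
Proof.
move=> u e /L2E fu e0.
have ee : 0 < e ^+ 2 / 2 by rewrite divr_gt0// exprn_gt0.
have Dm v : form_domain alpha V v -> cmeasurable v.
  by move=> /(form_domainP d0 m0 al0 al2 mV c0 Vc)[[]].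
have [_ _ Dl _ _] := schrodinger_quadratic_form d0 m0 al0 al2 mV c0 Vc.
have [v Dv vu] := approximable_L2 Dm Dl lipschitz_form_domain fu ee.
exists v => //; apply: L2norm_lt => //; apply: le_lt_trans vu _.
by rewrite lte_fin; have := exprn_gt0 2 e0; lra.
Qed.

End test_functions.

Section lebesgue_classes.
Context {R : realType} (d : nat) (V : d.-tuple R -> R).

Lemma Lfun_locally_integrable (p : R) : 1 <= p -> V \in Lfun (leb R d) p%:E ->
  forall n : nat, (\int[leb R d]_x (`|V x| * \1_(@cube R d n%:R) x)%:E < +oo)%E.
Proof.
move=> p1 Vp n.
have mV : measurable_fun setT V by move: (sub_Lfun_mfun Vp); rewrite inE.
have /integrableP[_] := Lfun_integrable p1 Vp.
under eq_integral do rewrite gee0_abs ?lee_fin ?powR_ge0//.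
move=> iV; have mc := @measurable_cube R d n%:R.
have mi : measurable_fun setT (fun x => (\1_(@cube R d n%:R) x)%:E : \bar R).
  by apply/measurable_EFinP; exact: measurable_indic.
have mVp : measurable_fun setT (fun x => (`|V x| `^ p)%:E).
  apply/measurable_EFinP; apply: (measurableT_comp (measurable_powR _)).
  exact: measurableT_comp.
apply: (@le_lt_trans _ _ (\int[leb R d]_x
    ((\1_(@cube R d n%:R) x)%:E + (`|V x| `^ p)%:E))%E).
  apply: ge0_le_integral.
  - by [].
  - by move=> x _; rewrite lee_fin mulr_ge0// indicE ler0n.
  - apply/measurable_EFinP; apply: measurable_funM; first exact: measurableT_comp.
    exact: measurable_indic.
  - exact: emeasurable_funD.
  - move=> x _; rewrite -EFinD lee_fin indicE.
    case: (x \in _); last by rewrite mulr0 add0r powR_ge0.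
    rewrite mulr1; have [V1|V1] := leP `|V x| 1.
      by rewrite -[leLHS]addr0 lerD// powR_ge0.
    by rewrite -[leLHS]add0r lerD// -{1}(powRr1 (normr_ge0 (V x))) ler_powR// ltW.
rewrite ge0_integralD//.
by rewrite lte_add_pinfty// integral_indic// setIT leb_cube// ltry.
Qed.

Lemma Lfun_infty_ae_bound : V^\- \in Lfun (leb R d) +oo%E ->
  exists2 c, 0 <= c & {ae leb R d, forall x, - c <= V x}.
Proof.
move=> /sub_Lfun_finLfun; rewrite inE /finite_norm unlock/=.
have [mu0|mu0] := ltP 0%E (leb R d setT); last first.
  move=> _; exists 0 => //; exists setT; split => //.
  by apply/eqP; rewrite eq_le mu0 measure_ge0.
move=> es; have [c c0 cs] : exists2 c : R, 0 <= c &
    (ess_sup (leb R d) (abse \o (EFin \o V^\-%R)) <= c%:E)%E.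
  move: es; case: (ess_sup _ _) => [r _| |_];
    [|by rewrite ltxx|by exists 0; rewrite ?leNye].
  by exists (Num.max r 0); rewrite ?lee_fin le_max lexx ?orbT.
exists c => //; have /ess_supP := cs; apply: filterS => x /=.
rewrite lee_fin => /(le_trans (ler_norm _)).
by rewrite /funrneg ge_max => /andP[Vx _]; rewrite lerNl.
Qed.

End lebesgue_classes.

Theorem theorem5p3 (R : realType) (d : nat) (hd : (1 <= d <= 3)%N)
    (m : R) (hm : 0 <= m) (p : R) (hp : 4 <= p)
    (V : d.-tuple R -> R) (hV : Rbar_critical m p V)
    (hVneg : V^\- \in Lfun (leb R d) +oo%E) :
  self_adjoint_form_sense m (d%:R / 2) V.
Proof.
have /andP[d1 d3] := hd; have [Vp _] := hV.
have mV : measurable_fun setT V by move: (sub_Lfun_mfun Vp); rewrite inE.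
have al0 : 0 < d%:R / 2 :> R by rewrite divr_gt0// ltr0n.
have al2 : d%:R / 2 < 2 :> R.
  have : d%:R <= 3 :> R by rewrite ler_nat.
  lra.
have [c c0 Vc] := Lfun_infty_ae_bound hVneg.
have p1 : 1 <= p by lra.
have Vloc := Lfun_locally_integrable p1 Vp.
split.
- exact: schrodinger_quadratic_form d1 hm al0 al2 mV c0 Vc.
- exact: form_domain_dense d1 hm al0 al2 mV c0 Vc Vloc.
- exact: schrodinger_bounded_below d1 hm al0 al2 mV c0 Vc.
- exact: schrodinger_lower_semicontinuous d1 hm al0 al2 mV c0 Vc.
Qed.
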